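(* Let $X$ be a bounded convex domain of $\mathbb{R}^d$, let $I_\delta:\mathcal{C}(X)\to E_\delta$ be an interpolation operator satisfying (L1)--(L3) with constant $C_I\ge 1$, and let $M_\varepsilon$ be the set of discretized convexity constraints on $X$ with parameter $\varepsilon>0$. Let $\mathcal{H}$ be the set of continuous convex functions on $X$ and $\mathrm{B}_{\mathrm{Lip}}^\gamma$ the set of $\gamma$-Lipschitz functions on $X$. Below, $C(d)$ denotes a constant depending only on the dimension $d$, and $C$ denotes an absolute constant. Then, assuming $\gamma\ge 2C_I\,\mathrm{diam}(X)$, $$\mathrm{d}_{\mathrm{H}}\left(\mathrm{B}_{\mathrm{Lip}}^\gamma\cap E_\delta\cap\mathcal{H}_{M_\varepsilon}\ \middle|\ \mathrm{B}_{\mathrm{Lip}}^\gamma\cap\mathcal{H}\right)\le C(d)\,\gamma\,\varepsilon,$$ $$\mathrm{d}_{\mathrm{H}}\left(\mathrm{B}_{\mathrm{Lip}}^{\gamma/C_I}\cap\mathcal{H}\ \middle|\ \mathrm{B}_{\mathrm{Lip}}^\gamma\cap E_\delta\cap\mathcal{H}_{M_\varepsilon}\right)\le C\,\frac{\gamma^2\delta}{\varepsilon^2}\,\mathrm{diam}(X).$$ Let $\mathrm{B}_{\mathcal{C}^{1,1}}^\kappa$ be the set of functions on $X$ with $\kappa$-Lipschitz gradients ($\kappa\ge 1$). Then $$\mathrm{d}_{\mathrm{H}}\left(\mathrm{B}_{\mathcal{C}^{1,1}}^\kappa\cap\mathcal{H}\ \middle|\ E_\delta\cap\mathcal{H}_{M_\varepsilon}\right)\le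 C\,\kappa^2\,\mathrm{diam}(X)^2\,\frac{\delta^2}{\varepsilon^2}.$$
   Context: $\mathcal{C}(X)$ is the space of bounded continuous functions on $X$ with the uniform norm $\|\cdot\|_\infty$; $\mathrm{Lip}(g)$ is the Lipschitz constant of $g$. For a set $L$ of affine forms on $\mathcal{C}(X)$, $\mathcal{H}_L:=\{g\in\mathcal{C}(X):\ \forall \ell\in L,\ \ell(g)\le 0\}$. The domain $X$ is understood to contain its boundary $\partial X$. Discretized convexity constraints. For $x\neq y$ in $X$ and $z\in[x,y]$, set $\ell_{xyz}(g):=g(z)-\frac{\|z-y\|}{\|x-y\|}g(x)-\frac{\|x-z\|}{\|x-y\|}g(y)$. Let $U_\varepsilon\subseteq\partial X$ be such that every $x\in\partial X$ admits $x_\varepsilon\in U_\varepsilon$ with $\|x-x_\varepsilon\|\le\varepsilon$. For distinct $p,q\in U_\varepsilon$ let $c_{pq}:=\{p+\varepsilon i\frac{q-p}{\|q-p\|}:\ i\in\mathbb{N},\ 0\le i\le\|q-p\|/\varepsilon\}$. Then $M_\varepsilon:=\{\ell_{xyz}:\ x,y,z\in c_{pq}\text{ for some }p,q\in U_\varepsilon\text{ and }z\in[x,y]\}$. Interpolation operator. A (linear) interpolation operator is a continuous linear map $I_\delta$ from $\mathcal{C}(X)$ to a finite-dimensional linear subspace $E_\delta\subseteq\mathcal{C}(X)$ whose restriction to $E_\delta$ is the identity; it is assumed that $E_\delta$ contains the affine functions on $X$ and that: (L1) $\mathrm{Lip}(I_\delta g)\le C_I\,\mathrm{Lip}(g)$;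 (L2) $\|g-I_\delta g\|_\infty\le\delta\,\mathrm{Lip}(g)$; (L3) $\|g-I_\delta g\|_\infty\le\frac12\delta^2\,\mathrm{Lip}(\nabla g)$. Directed (half-)Hausdorff distance. For subsets $A,B$ of $\mathcal{C}(X)$, $\mathrm{d}_{\mathrm{H}}(A\,|\,B):=\min\{r\ge 0:\ \forall f\in A,\ \exists g\in B,\ \|f-g\|_\infty\le r\}$.
   Formalization: The second and third estimates are stated for ε ≤ diam(X); for larger ε the constraint set M_ε is empty, the left sides no longer depend on ε and the printed bounds fail as ε grows. Also δ > 0 is made explicit. *)

(* Defs.v *)
From HB Require Import structures.
From mathcomp Require Import all_boot all_order all_algebra.
From mathcomp Require Import all_classical all_reals all_analysis.

Set Implicit Arguments.
Unset Strict Implicit.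
Unset Printing Implicit Defensive.

Import Order.TTheory GRing.Theory Num.Theory.
Import numFieldNormedType.Exports.

Local Open Scope classical_set_scope.
Local Open Scope ring_scope.

Section Euclidean.
Context {R : realType} {d : nat}.
Implicit Types (x y p q : 'rV[R]_d) (X : set 'rV[R]_d).

(* The library norm on ['rV[R]_d] is the sup norm; it is used below only through
   the topology (and the bounded sets) it induces. *)
Definition enorm x : R := Num.sqrt (\sum_(i < d) x ord0 i ^+ 2).

Definition diam X : R := sup [set enorm (x - y) | x in X & y in X].

Definition boundary X : set 'rV[R]_d := closure X `\` X°.

Definition segment x y : set 'rV[R]_d :=
  [set x + t *: (y - x) | t in `[0, 1]].

(* A domain is taken together with its boundary. *)
Definition bounded_convex_domain X : Prop :=
  [/\ closed X, bounded_set X, convex_set X & X° !=set0].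

Definition boundary_net X (eps : R) (U : set 'rV[R]_d) : Prop :=
  U `<=` boundary X /\
  forall x, boundary X x -> exists2 u, U u & enorm (x - u) <= eps.

Definition grid (eps : R) p q : set 'rV[R]_d :=
  [set p + (eps * i%:R / enorm (q - p)) *: (q - p)
     | i in [set i : nat | i%:R <= enorm (q - p) / eps]].

End Euclidean.

(* Functions on X are functions on the subtype [set_type X] (to which X is
   coerced), so that equality of functions is equality on X. *)
Section FunctionsOnX.
Context {R : realType} {d : nat} (X : set 'rV[R]_d).
Implicit Types (f g : X -> R) (x y z : X).

Definition Cb : set (X -> R) :=
  [set g | continuous g /\ [bounded g x | x in [set: X]]].

Definition unorm g : \bar R := ereal_sup [set `|g x|%:E | x in [set: X]].

Definition klip (k : R) g : Prop :=
  forall x y, `|g x - g y| <= k * enorm (set_val x - set_val y).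

(* Both constants below are +oo when there is no admissible k. *)
Definition Lip g : \bar R :=
  ereal_inf [set k%:E | k in [set k : R | 0 <= k /\ klip k g]].

(* [valL_ 0 g] extends g by 0 outside X; at interior points of X this does not
   affect differentiability or derivatives. *)
Definition grad g (x : 'rV[R]_d) : 'rV[R]_d :=
  \row_(i < d) 'D_(delta_mx ord0 i) (valL_ 0 g) x.

(* For continuous g, a k-Lipschitz gradient on the interior of X extends to a
   k-Lipschitz gradient on X, so the interior carries all the information. *)
Definition klip_grad (k : R) g : Prop :=
  (forall x : 'rV[R]_d, X° x -> differentiable (valL_ 0 g) x) /\
  (forall x y : 'rV[R]_d, X° x -> X° y ->
     enorm (grad g x - grad g y) <= k * enorm (x - y)).

Definition Lip_grad g : \bar R :=
  ereal_inf [set k%:E | k in [set k : R | 0 <= k /\ klip_grad k g]].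

Definition BLip (gamma : R) : set (X -> R) := [set g | klip gamma g].

Definition BC11 (kappa : R) : set (X -> R) := [set g | klip_grad kappa g].

(* The continuous convex functions on X. *)
Definition Hconv : set (X -> R) :=
  [set g | Cb g /\ convex_function X (valL_ 0 g)].

Definition Hcons (L : set ((X -> R) -> R)) : set (X -> R) :=
  [set g | Cb g /\ forall l, L l -> l g <= 0].

Definition ell x y z g : R :=
  let n (u v : X) := enorm (set_val u - set_val v) in
  g z - n z y / n x y * g x - n x z / n x y * g y.

Definition Mconstr (eps : R) (U : set 'rV[R]_d) : set ((X -> R) -> R) :=
  [set l | exists p q x y z,
     [/\ [/\ U p, U q & p <> q],
         [/\ grid eps p q (set_val x), grid eps p q (set_val y)
           & grid eps p q (set_val z)],
         x <> y, segment (set_val x) (set_val y) (set_val z) &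
         l = ell x y z]].

Definition finite_dim_subspace (E : set (X -> R)) : Prop :=
  exists (n : nat) (e : 'I_n -> X -> R),
    E = [set g | exists a : 'I_n -> R, g = \sum_(i < n) a i *: e i].

Definition affine_fun (a : 'rV[R]_d) (b : R) : X -> R :=
  fun x => \sum_(i < d) a ord0 i * set_val x ord0 i + b.

(* An operator on C(X) is given by a map on all functions, of which only the
   values on C(X) are ever used. *)
Record interpolation_operator (E : set (X -> R)) (I : (X -> R) -> X -> R)
    (CI delta : R) : Prop := InterpolationOperator {
  interp_sub : E `<=` Cb ;
  interp_findim : finite_dim_subspace E ;
  interp_affine : forall a b, E (affine_fun a b) ;
  interp_range : forall g, Cb g -> E (I g) ;
  interp_linear : forall (a : R) f g, Cb f -> Cb g ->
    I (a *: f + g) = a *: I f + I g ;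
  interp_continuous : forall f, Cb f -> forall e : R, 0 < e ->
    exists2 r : R, 0 < r &
      forall g, Cb g -> (unorm (f - g)%R < r%:E)%E ->
        (unorm (I f - I g)%R < e%:E)%E ;
  interp_id : forall g, E g -> I g = g ;
  interp_L1 : forall g, Cb g -> (Lip (I g) <= CI%:E * Lip g)%E ;
  interp_L2 : forall g, Cb g -> (unorm (g - I g)%R <= delta%:E * Lip g)%E ;
  interp_L3 : forall g, Cb g ->
    (unorm (g - I g)%R <= (delta ^+ 2 / 2)%:E * Lip_grad g)%E
}.

(* Directed Hausdorff distance; the infimum of the admissible radii is their
   minimum whenever the latter exists, and it is +oo if there is none. *)
Definition dH (A B : set (X -> R)) : \bar R :=
  ereal_inf [set r%:E | r in [set r : R | 0 <= r /\
    forall f, A f -> exists2 g, B g & (unorm (f - g)%R <= r%:E)%E]].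

End FunctionsOnX.

Arguments BLip {R d} X gamma.
Arguments BC11 {R d} X kappa.
Arguments Mconstr {R d} X eps U.
Arguments Hconv {R d} X.
Arguments Cb {R d} X.

(* Main.v *)
(* Write K = 8 gamma eps. If g is gamma-Lipschitz and convex on the grids, then
   g is convex up to K along every segment of X: prolong the segment to the
   boundary, replace the two exit points by points of the net, and round the
   three points to the grid joining them. By Caratheodory's theorem, Jensen's
   inequality then holds up to d K for all convex combinations, so the largest
   convex gamma-Lipschitz minorant of g, the infimum of
   sum_i l_i g(y_i) + gamma |x - sum_i l_i y_i|, stays within d K of g.

   Conversely, for convex f, mix f with a strictly convex quadratic function:
   h = (1 - t) f + t (A + |x - x0|^2) with A affine. Since distinct grid points
   are at distance at least eps, the constraints hold for h with a margin
   t eps^2, which absorbs twice the interpolation error for t of order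
   gamma delta / eps^2 (resp. kappa delta^2 / eps^2). If this value exceeds 1,
   then A itself, a constant or the tangent of f at x0, is close enough. *)

Require Import Defs.
From mathcomp Require Import all_boot all_order all_algebra.
From mathcomp Require Import all_classical all_reals all_analysis.
From mathcomp Require Import ring lra.
Import Order.TTheory GRing.Theory Num.Theory.
Import numFieldNormedType.Exports.

Set Implicit Arguments.
Unset Strict Implicit.
Unset Printing Implicit Defensive.

Local Open Scope classical_set_scope.
Local Open Scope ring_scope.

(** * The Euclidean norm and its comparison with the sup norm *)

Section EuclideanNorm.
Context {R : realType} {d : nat}.
Implicit Types u v w x y : 'rV[R]_d.

Definition dotv u v : R := \sum_(i < d) u ord0 i * v ord0 i.

Lemma dotvC u v : dotv u v = dotv v u.
Proof. by apply: eq_bigr => i _; rewrite mulrC. Qed.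

Lemma dotvDl u v w : dotv (u + v) w = dotv u w + dotv v w.
Proof. by rewrite -big_split; apply: eq_bigr => i _; rewrite mxE mulrDl. Qed.

Lemma dotvZl a u v : dotv (a *: u) v = a * dotv u v.
Proof. by rewrite mulr_sumr; apply: eq_bigr => i _; rewrite mxE mulrA. Qed.

Lemma dotvDr u v w : dotv w (u + v) = dotv w u + dotv w v.
Proof. by rewrite dotvC dotvDl !(dotvC w). Qed.

Lemma dotvZr a u v : dotv u (a *: v) = a * dotv u v.
Proof. by rewrite dotvC dotvZl dotvC. Qed.

Lemma dotvNl u v : dotv (- u) v = - dotv u v.
Proof. by rewrite -scaleN1r dotvZl mulN1r. Qed.

Lemma dotvBl u v w : dotv (u - v) w = dotv u w - dotv v w.
Proof. by rewrite dotvDl dotvNl. Qed.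

Lemma dotvBr u v w : dotv w (u - v) = dotv w u - dotv w v.
Proof. by rewrite dotvC dotvBl !(dotvC w). Qed.

Lemma dotv_ge0 u : 0 <= dotv u u.
Proof. by apply: sumr_ge0 => i _; rewrite -expr2 sqr_ge0. Qed.

Lemma enormE u : enorm u = Num.sqrt (dotv u u).
Proof. by congr Num.sqrt; apply: eq_bigr => i _; rewrite expr2. Qed.

Lemma enorm_ge0 u : 0 <= enorm u. Proof. exact: sqrtr_ge0. Qed.

Lemma sqr_enorm u : enorm u ^+ 2 = dotv u u.
Proof. by rewrite enormE sqr_sqrtr ?dotv_ge0. Qed.

Lemma enorm_eq0 u : enorm u = 0 -> u = 0.
Proof.
move=> u0; have /eqP : dotv u u = 0 by rewrite -sqr_enorm u0 expr0n.
rewrite psumr_eq0 => [/allP uu0|i _]; last by rewrite -expr2 sqr_ge0.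
apply/rowP => i; have := uu0 i (mem_index_enum i).
by rewrite mulf_eq0 orbb mxE => /eqP.
Qed.

Lemma enorm_gt0 u : u != 0 -> 0 < enorm u.
Proof.
by move=> u0; rewrite lt_neqAle enorm_ge0 andbT eq_sym; apply: contra u0 =>
    /eqP/enorm_eq0->.
Qed.

Lemma dotv0l u : dotv 0 u = 0.
Proof. by apply: big1 => i _; rewrite mxE mul0r. Qed.

Lemma CauchySchwarz u v : dotv u v <= enorm u * enorm v.
Proof.
have [->|/enorm_gt0 up] := eqVneq u 0; first by rewrite dotv0l mulr_ge0 ?enorm_ge0.
have [->|/enorm_gt0 vp] := eqVneq v 0; first by rewrite dotvC dotv0l mulr_ge0
    ?enorm_ge0.
have uvp := mulr_gt0 up vp; rewrite -(ler_pM2l uvp) -subr_ge0.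
have := dotv_ge0 (enorm v *: u - enorm u *: v).
rewrite -scaleNr dotvDl !dotvDr !dotvZl !dotvZr (dotvC v u) -!sqr_enorm.
by set a := enorm u; set b := enorm v; nra.
Qed.

Lemma enormD u v : enorm (u + v) <= enorm u + enorm v.
Proof.
rewrite -(@ler_pXn2r _ 2) // ?nnegrE ?addr_ge0 ?enorm_ge0 //.
rewrite sqrrD !sqr_enorm dotvDl !dotvDr (dotvC v u).
by have := CauchySchwarz u v; rewrite -!sqr_enorm; lra.
Qed.

Lemma enormZ a u : enorm (a *: u) = `|a| * enorm u.
Proof.
by rewrite !enormE dotvZl dotvZr mulrA -expr2 sqrtrM ?sqr_ge0// sqrtr_sqr.
Qed.

Lemma enormN u : enorm (- u) = enorm u.
Proof. by rewrite -scaleN1r enormZ normrN1 mul1r. Qed.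

Lemma enorm0 : enorm (0 : 'rV[R]_d) = 0.
Proof. by rewrite -(scale0r 0) enormZ normr0 mul0r. Qed.

Lemma enormBC u v : enorm (u - v) = enorm (v - u).
Proof. by rewrite -enormN opprB. Qed.

Lemma enorm_triangle w u v : enorm (u - v) <= enorm (u - w) + enorm (w - v).
Proof. by rewrite -(subrKA w u (- v)) enormD. Qed.

Lemma norm_dotv_le u v : `|dotv u v| <= enorm u * enorm v.
Proof.
by rewrite ler_norml CauchySchwarz andbT lerNl -dotvNl -(enormN u) CauchySchwarz.
Qed.

Lemma coord_le_enorm u i : `|u ord0 i| <= enorm u.
Proof.
rewrite -sqrtr_sqr ler_wsqrtr// (bigD1 i)//= lerDl.
by apply: sumr_ge0 => j _; rewrite sqr_ge0.
Qed.

Lemma norm_le_enorm u : `|u| <= enorm u.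
Proof.
rewrite [leLHS]/Num.norm /= mx_normrE; apply: bigmax_le; first exact: enorm_ge0.
by move=> [i j] _ /=; rewrite (ord1 i) coord_le_enorm.
Qed.

Lemma enorm_le_norm u : enorm u <= d%:R * `|u|.
Proof.
have h i : `|u ord0 i| <= `|u|.
  rewrite [leRHS]/Num.norm /= mx_normrE.
  exact: (le_bigmax _ (fun ij : 'I_1 * 'I_d => `|u ij.1 ij.2|) (ord0, i)).
have h0 : 0 <= d%:R * `|u| by rewrite mulr_ge0 ?normr_ge0.
rewrite -(@ler_pXn2r _ 2) // ?nnegrE ?enorm_ge0// sqr_enorm exprMn.
apply: (@le_trans _ _ (\sum_(i < d) `|u| ^+ 2)).
  apply: ler_sum => i _; rewrite -expr2 -real_normK ?num_real//.
  by rewrite ler_pXn2r ?nnegrE ?normr_ge0.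
rewrite sumr_const card_ord -[leLHS]mulr_natl ler_wpM2r ?sqr_ge0//.
case: (d) => [|n]; first by rewrite expr0n.
by rewrite expr2 -natrM ler_nat leq_pmulr.
Qed.

End EuclideanNorm.

(** * Functions on the domain: Lipschitz constants, convexity, interior points *)

Section Domain.
Context {R : realType} {d : nat} {X : set 'rV[R]_d}.
Implicit Types (x y z : 'rV[R]_d) (f g : X -> R).

Lemma setX_val x : X x -> exists x' : X, set_val x' = x.
Proof. by move=> Xx; exists (SigSub (mem_set Xx)); rewrite set_valE. Qed.

Lemma set_valX (x : X) : X (set_val x).
Proof. by rewrite set_valE; exact/set_mem/(valP x). Qed.

Lemma valL_val g (x : X) : valL_ 0 g (set_val x) = g x.
Proof. by have /(congr1 (fun h => h x)) := valLK 0 g; rewrite /sigL. Qed.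

Lemma valL_out g x : ~ X x -> valL_ 0 g x = 0.
Proof.
by move=> Xx; rewrite /valL_ /= oinv_set_val insubN//; apply/negP => /set_mem.
Qed.

Lemma set_val_inj (x y : X) : set_val x = set_val y -> x = y.
Proof. by rewrite set_valE; exact: val_inj. Qed.

Lemma unorm_leP f r : (forall x : X, `|f x| <= r) <-> (unorm f <= r%:E)%E.
Proof.
split=> [fr|fr x]; first by apply: ub_ereal_sup => _ [x _ <-]; rewrite lee_fin.
by rewrite -lee_fin (le_trans _ fr)//; apply: ereal_sup_ubound; exists x.
Qed.

Lemma klip_Lip_le g k : 0 <= k -> klip k g -> (Lip g <= k%:E)%E.
Proof. by move=> k0 gk; apply: ereal_inf_lbound; exists k. Qed.

(** An infimum only provides constants close to [k], so the inequality is proved up to every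
    [e > 0]. *)
Lemma Lip_le_klip g k : (Lip g <= k%:E)%E -> klip k g.
Proof.
move=> gk x y; set n := enorm _; have n0 : 0 <= n by exact: enorm_ge0.
apply/ler_addgt0Pr => e e0.
(* The denominator is [n + 1] because [n] vanishes when [x = y]. *)
have e1 : 0 < e / (n + 1) by rewrite divr_gt0// ltr_wpDl.
have : (Lip g < (k + e / (n + 1))%:E)%E.
  by rewrite (le_lt_trans gk)// lte_fin ltrDl.
move=> /ereal_inf_lt[_ [k' [k'0 /(_ x y) gk'] <-]]; rewrite lte_fin -/n => k'k.
rewrite (le_trans gk')// (le_trans (ler_wpM2r n0 (ltW k'k)))//.
rewrite mulrDl lerD2l mulrAC ler_pdivrMr ?ltr_wpDl// ler_pM2l//.
by rewrite lerDl.
Qed.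

Lemma klip_grad_Lip_grad_le g k : 0 <= k -> klip_grad k g -> (Lip_grad g <= k%:E)%E.
Proof. by move=> k0 gk; apply: ereal_inf_lbound; exists k. Qed.

Lemma dH_le (A B : set (X -> R)) r : 0 <= r ->
  (forall f, A f -> exists2 g, B g & forall x : X, `|f x - g x| <= r) ->
  (dH A B <= r%:E)%E.
Proof.
move=> r0 AB; apply: ereal_inf_lbound; exists r => //; split=> // f /AB[g Bg fg].
by exists g => //; apply/unorm_leP.
Qed.

Hypothesis domX : bounded_convex_domain X.

Lemma enorm_le_diam x y : X x -> X y -> enorm (x - y) <= diam X.
Proof.
move=> Xx Xy; case: domX => _ [M [_ MX]] _ _.
apply: ub_le_sup; last by exists x => //; exists y.
exists (d%:R * (M + 1) + d%:R * (M + 1)) => _ [u Xu [v Xv <-]].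
rewrite (le_trans (enormD _ _))// enormN.
by rewrite lerD// (le_trans (enorm_le_norm _))// ler_wpM2l// MX// ltrDl.
Qed.

Lemma diam_ge0 : 0 <= diam X.
Proof.
case: (domX) => _ _ _ [x /interior_subset Xx].
by rewrite (le_trans _ (enorm_le_diam Xx Xx))// enorm_ge0.
Qed.

Lemma convX x y t : X x -> X y -> 0 <= t <= 1 -> X ((1 - t) *: x + t *: y).
Proof.
move=> Xx Xy /andP[t0 t1]; case: domX => _ _ cX _.
have t0' : 0 <= 1 - t by rewrite subr_ge0.
have t1' : 1 - t <= 1 by rewrite lerBlDr lerDl.
have := cX x y (Itv01 t0' t1') (mem_set Xx) (mem_set Xy).
by rewrite in_setE /conv /= /unstable.onem subKr.
Qed.

Lemma convex_functionP g : convex_function X (valL_ 0 g) <->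
  forall (x y z : X) t, 0 <= t <= 1 ->
    set_val z = (1 - t) *: set_val x + t *: set_val y ->
    g z <= (1 - t) * g x + t * g y.
Proof.
split=> [cg x y z t /andP[t0 t1] zE|cg t x y].
  have t0' : 0 <= 1 - t by rewrite subr_ge0.
  have t1' : 1 - t <= 1 by rewrite lerBlDr lerDl.
  have : valL_ 0 g ((1 - t) *: set_val x + (1 - (1 - t)) *: set_val y) <=
      (1 - t) * valL_ 0 g (set_val x) + (1 - (1 - t)) * valL_ 0 g (set_val y).
    exact: (cg (Itv01 t0' t1') _ _ (mem_set (set_valX x)) (mem_set (set_valX y))).
  by rewrite subKr -zE !valL_val.
move=> /set_mem/[dup] Xx /setX_val[x' x'E] /set_mem/[dup] Xy /setX_val[y' y'E].
have t01 : 0 <= 1 - t%:num <= 1 by rewrite subr_ge0 lerBlDr lerDl ge0 le1.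
have := convX Xx Xy t01; rewrite subKr => /setX_val[z' z'E].
have := cg x' y' z' _ t01; rewrite subKr x'E y'E => /(_ z'E).
rewrite -!valL_val x'E y'E z'E; exact.
Qed.

(** Boundedness comes from the finite diameter, continuity from the bound of the Euclidean norm by
    [d] times the sup norm. The sign of [k] is arbitrary, hence the bounds by [|k|]. *)
Lemma klip_Cb k g : klip k g -> Cb X g.
Proof.
move=> gk; split; last first.
  case: (domX) => _ _ _ [_ /interior_subset/setX_val[x0 _]].
  exists (`|g x0| + `|k| * diam X); split; [exact: num_real|move=> M kM];
      move=> x _ /=.
  rewrite (le_trans _ (ltW kM))//.
  rewrite -(subrK (g x0) (g x)) addrC (le_trans (ler_normD _ _))// lerD2l.
  rewrite (le_trans (gk _ _))// (@le_trans _ _ (`|k| * enorm (set_val x -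
      set_val x0)))//.
    by rewrite ler_wpM2r ?enorm_ge0 ?ler_norm.
  rewrite ler_wpM2l//; exact: enorm_le_diam (set_valX _) (set_valX _).
move=> x; apply/(@cvgrPdist_lt _ _ _ _ (nbhs_filter x)) => e e0.
have cs : continuous (set_val : X -> 'rV[R]_d) by exact: (@initial_continuous X
    _ set_val).
have /(@cvgrPdist_lt _ _ _ _ (nbhs_filter x)) := cs x.
have c0 : 0 < e / (`|k| * d%:R + 1) by rewrite divr_gt0// ltr_wpDl.
move=> /(_ _ c0); apply: filterS => y xy.
rewrite (le_lt_trans (gk _ _))// (@le_lt_trans _ _ (`|k| * (d%:R * `|set_val x
    - set_val y|)))//.
  rewrite (@le_trans _ _ (`|k| * enorm (set_val x - set_val y)))//.
    by rewrite ler_wpM2r ?enorm_ge0 ?ler_norm.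
  by rewrite ler_wpM2l ?enorm_le_norm.
rewrite mulrA (@le_lt_trans _ _ ((`|k| * d%:R + 1) * `|set_val x - set_val y|))//.
  by rewrite ler_wpM2r// lerDl.
by rewrite mulrC -ltr_pdivlMr// ltr_wpDl.
Qed.

Lemma interior_enorm x : X° x ->
  exists2 r, 0 < r & forall y, enorm (y - x) < r -> X y.
Proof.
move=> /nbhs_normP[r /= r0 rX]; exists r => // y yx; apply: rX => /=.
by rewrite (le_lt_trans (norm_le_enorm _))// enormBC.
Qed.

Lemma enorm_interior x r : 0 < r -> (forall y, enorm (y - x) < r -> X y) -> X° x.
Proof.
(* A sup-norm ball has to fit into the Euclidean one; [d + 1] keeps the denominator positive for
   [d = 0]. *)
move=> r0 rX; apply/(@nbhs_normP _ _ x X); exists (r / (d%:R + 1)) => /=.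
  by rewrite divr_gt0// ltr_wpDl.
move=> y /=; rewrite ltr_pdivlMr ?ltr_wpDl// => yx; apply: rX.
rewrite enormBC (le_lt_trans (enorm_le_norm _))// (le_lt_trans _ yx)//.
by rewrite mulrC ler_wpM2l// lerDl.
Qed.

End Domain.

(** * Exit points on the boundary and the constraints in barycentric form *)

Section BoundaryPoints.
Context {R : realType} {d : nat} {X : set 'rV[R]_d}.
Hypothesis domX : bounded_convex_domain X.
Implicit Types (x y z p q : 'rV[R]_d).

Lemma closed_enorm p :
  (forall r, 0 < r -> exists2 y, X y & enorm (y - p) < r) -> X p.
Proof.
case: domX => cX _ _ _ Xp; apply: cX => B /nbhs_normP[r /= r0 rB].
have [y Xy yp] := Xp r r0; exists y; split=> //; apply: rB => /=.
by rewrite (le_lt_trans (norm_le_enorm _))// enormBC.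
Qed.

(** The last point of the ray in [X] works: the parameters are bounded by the diameter, closedness
    keeps the supremum in [X], and a ball around it inside [X] would let the ray go further. *)
Lemma ray_boundary x y : X x -> X y -> x != y ->
  exists2 t, 1 <= t & boundary X (x + t *: (y - x)).
Proof.
move=> Xx Xy xy; set v := y - x.
have n0 : 0 < enorm v by rewrite enorm_gt0// subr_eq0 eq_sym.
pose S := [set t : R | 1 <= t /\ X (x + t *: v)].
have S1 : S 1 by split=> //; rewrite scale1r addrC subrK.
have Sub : has_ubound S.
  exists (diam X / enorm v) => t [t1 Xt]; rewrite ler_pdivlMr//.
  have := enorm_le_diam domX Xt Xx.
  by rewrite addrC addKr enormZ ger0_norm// (le_trans _ t1).
have supS : has_sup S by split=> //; exists 1.
have T1 : 1 <= sup S by exact: ub_le_sup.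
exists (sup S) => //; split.
  apply: subset_closure; apply: closed_enorm => r r0.
  have [t [t1 Xt] tT] := sup_adherent (divr_gt0 r0 n0) supS.
  exists (x + t *: v) => //; rewrite opprD addrACA subrr add0r -scalerBl enormZ.
  rewrite -ltr_pdivlMr// distrC ger0_norm ?subr_ge0 ?ltrBlDr -?ltrBlDl//.
  exact: ub_le_sup.
move=> /interior_enorm[r r0 rX].
suff /(ub_le_sup Sub) : S (sup S + r / 2 / enorm v).
  by apply/negP; rewrite -ltNge ltrDl !divr_gt0.
have e0 : 0 < r / 2 / enorm v by rewrite !divr_gt0.
split; first by rewrite (le_trans T1)// lerDl ltW.
apply: rX; rewrite opprD addrACA subrr add0r -scalerBl enormZ (addrC (sup S)) addrK.
by rewrite gtr0_norm// divfK ?gt_eqF//; lra.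
Qed.

(** The quotients of distances in [ell] are the barycentric coordinates of [z] on the segment. *)
Lemma ell_affine_param (x y z : X) t g : x <> y -> 0 <= t <= 1 ->
  set_val z = set_val x + t *: (set_val y - set_val x) ->
  ell x y z g = g z - (1 - t) * g x - t * g y.
Proof.
move=> xy /andP[t0 t1] zE; rewrite /ell.
have n0 : enorm (set_val x - set_val y) != 0.
  by apply/eqP => /enorm_eq0/eqP; rewrite subr_eq0 => /eqP/set_val_inj.
have -> : set_val x - set_val z = t *: (set_val x - set_val y).
  by rewrite zE opprD addNKr -scalerN opprB.
have -> : set_val z - set_val y = (1 - t) *: (set_val x - set_val y).
  by rewrite zE scalerBl scale1r addrAC -scalerN opprB.
rewrite !enormZ !ger0_norm ?subr_ge0// !mulfK//.
Qed.

End BoundaryPoints.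

(** * Approximate convexity from the grid constraints *)

Section ApproximateConvexity.
Context {R : realType} {d : nat} {X : set 'rV[R]_d} {eps : R} {U : set 'rV[R]_d}.
Hypotheses (domX : bounded_convex_domain X) (eps0 : 0 < eps) (netU :
    boundary_net X eps U).
Implicit Types (x y z p q : 'rV[R]_d) (g : X -> R).

Lemma boundary_sub : boundary X `<=` X.
Proof. by case: domX => cX _ _ _ x [/cX]. Qed.

Definition gridpt p q (i : nat) := p + (eps * i%:R / enorm (q - p)) *: (q - p).

(** One [eps] pays for moving the endpoints from [p'], [q'] to [p], [q], the other for rounding the
    distance from [p] down to a multiple of [eps]. *)
Lemma gridpt_near p q p' q' a :
  enorm (p' - p) <= eps -> enorm (q' - q) <= eps -> 0 <= a <= 1 ->
  enorm (p' + a *: (q' - p') - gridpt p q (Num.truncn (a * enorm (q - p) /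
      eps))) <= 2 * eps.
Proof.
move=> pp qq /andP[a0 a1]; set i := Num.truncn _.
rewrite (le_trans (enorm_triangle (p + a *: (q - p)) _ _))// mulrDl mul1r lerD//.
  have -> : p' + a *: (q' - p') - (p + a *: (q - p)) = (1 - a) *: (p' - p) + a
      *: (q' - q).
    by apply/rowP => k; rewrite !mxE; ring.
  rewrite (le_trans (enormD _ _))// !enormZ !ger0_norm ?subr_ge0//.
  by set u := enorm _ in pp *; set v := enorm _ in qq *; nra.
rewrite /gridpt opprD addrACA subrr add0r -scalerBl enormZ.
have [->|n0] := eqVneq (enorm (q - p)) 0; first by rewrite mulr0 ltW.
have np : 0 < enorm (q - p) by rewrite lt_neqAle eq_sym n0 enorm_ge0.
rewrite -[X in _ * X]gtr0_norm// -normrM mulrBl divfK//.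
have /truncn_itv/andP[] : 0 <= a * enorm (q - p) / eps.
  by rewrite divr_ge0 ?mulr_ge0 ?(ltW eps0) ?(ltW np).
rewrite -/i ler_pdivlMr// ltr_pdivrMr// -natr1 => h1 h2.
by rewrite ger0_norm; lra.
Qed.

(** Rounding down keeps the index in range, so the point lies between [p] and [q], which belong to
    the closed convex set [X]. *)
Lemma gridpt_mem p q (a : R) : U p -> U q -> 0 <= a <= 1 ->
  [/\ grid eps p q (gridpt p q (Num.truncn (a * enorm (q - p) / eps)))
    & X (gridpt p q (Num.truncn (a * enorm (q - p) / eps)))].
Proof.
move=> Up Uq /andP[a0 a1]; set i := Num.truncn _.
have [Ub _] := netU.
have i1 : i%:R <= enorm (q - p) / eps.
  have /truncn_itv/andP[h _] : 0 <= a * enorm (q - p) / eps.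
    by rewrite divr_ge0 ?mulr_ge0 ?enorm_ge0 ?(ltW eps0).
  rewrite (le_trans h)// ler_wpM2r ?invr_ge0 ?(ltW eps0)//.
  by rewrite ler_piMl ?enorm_ge0.
split; first by exists i.
have -> : gridpt p q i = (1 - eps * i%:R / enorm (q - p)) *: p + (eps * i%:R /
    enorm (q - p)) *: q.
  by apply/rowP => k; rewrite !mxE; ring.
apply: (convX domX); [exact/boundary_sub/Ub|exact/boundary_sub/Ub|].
rewrite divr_ge0 ?mulr_ge0 ?enorm_ge0 ?(ltW eps0)//=.
(* If [p = q], division by zero yields the parameter 0, still in the unit interval. *)
have [->|n0] := eqVneq (enorm (q - p)) 0; first by rewrite invr0 mulr0.
have np : 0 < enorm (q - p) by rewrite lt_neqAle eq_sym n0 enorm_ge0.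
by rewrite ler_pdivrMr// mul1r mulrC -ler_pdivlMr.
Qed.

(** Grid points are affine in their index, so the constraint is Jensen's inequality with weight
    [(k - i) / (j - i)]; [i < j] makes the outer points distinct, as [ell] requires. *)
Lemma gridpt_convex g p q (i j k : nat) : Hcons (Mconstr X eps U) g ->
  U p -> U q -> p <> q -> (i <= k <= j)%N -> (i < j)%N ->
  grid eps p q (gridpt p q i) -> grid eps p q (gridpt p q j) -> grid eps p q
      (gridpt p q k) ->
  X (gridpt p q i) -> X (gridpt p q j) -> X (gridpt p q k) ->
  exists s, [/\ 0 <= s <= 1,
   gridpt p q k = (1 - s) *: gridpt p q i + s *: gridpt p q j &
   valL_ 0 g (gridpt p q k) <= (1 - s) * valL_ 0 g (gridpt p q i) + s * valL_ 0
       g (gridpt p q j)].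
Proof.
move=> [Cg Hg] Up Uq pq /andP[ik kj] ij Gi Gj Gk.
have np : 0 < enorm (q - p) by rewrite enorm_gt0// subr_eq0 eq_sym; apply/eqP.
move=> /setX_val[x xE] /setX_val[y yE] /setX_val[z zE].
have ij' : 0 < j%:R - i%:R :> R by rewrite subr_gt0 ltr_nat.
pose s : R := (k%:R - i%:R) / (j%:R - i%:R).
have s0 : 0 <= s by rewrite divr_ge0 ?(ltW ij')// subr_ge0 ler_nat.
have s1 : s <= 1 by rewrite ler_pdivrMr// mul1r lerD2r ler_nat.
have s01 : 0 <= s <= 1 by rewrite s0.
have kE : gridpt p q k = gridpt p q i + s *: (gridpt p q j - gridpt p q i).
  apply/rowP => l; rewrite !mxE /s; field.
  by rewrite !gt_eqF.
have xy : x <> y.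
  move=> xy; have /eqP : gridpt p q i = gridpt p q j by rewrite -xE -yE xy.
  rewrite /gridpt (inj_eq (addrI _)) -subr_eq0 -scalerBl scaler_eq0 -mulrBl.
  rewrite -mulrBr !mulf_eq0 invr_eq0 -opprB oppr_eq0 !gt_eqF//=.
  by rewrite subr_eq0 => /eqP/esym.
have Ml : Mconstr X eps U (ell x y z).
  exists p, q, x, y, z; rewrite xE yE zE; split=> //.
  by exists s => //=; rewrite in_itv.
exists s; split=> //.
  by rewrite kE; apply/rowP => l; rewrite !mxE; ring.
have := Hg _ Ml; rewrite (@ell_affine_param _ _ _ _ _ _ s)//; last by rewrite
    xE yE zE.
by rewrite -!valL_val xE yE zE; lra.
Qed.

(** The constant 8 is 2 + 2 + 4: moving the middle point to the grid, moving the two endpoints (a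
    weighted mean of two errors), and replacing the grid weight [s] by [t]. *)
Lemma Hcons_approx_convex g gamma x y t : Hcons (Mconstr X eps U) g -> 0 <= gamma ->
  klip gamma g -> X x -> X y -> 0 <= t <= 1 ->
  valL_ 0 g ((1 - t) *: x + t *: y)
    <= (1 - t) * valL_ 0 g x + t * valL_ 0 g y + 8 * gamma * eps.
Proof.
move=> Hg gamma0 gL Xx Xy t01; have /andP[t0 t1] := t01.
have gL' u v : X u -> X v -> valL_ 0 g u <= valL_ 0 g v + gamma * enorm (u - v).
  move=> /setX_val[u' <-] /setX_val[v' <-]; rewrite !valL_val.
  by have := gL u' v'; rewrite ler_norml; lra.
have [->|xy] := eqVneq x y.
  rewrite -scalerDl subrK scale1r -mulrDl subrK mul1r lerDl.
  by rewrite !mulr_ge0 ?(ltW eps0).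
have [T T1 bq] := ray_boundary domX Xx Xy xy.
have [S S1 bp] : exists2 S, 1 <= S & boundary X (y + S *: (x - y)).
  by apply: ray_boundary => //; rewrite eq_sym.
set q' := x + _ in bq; set p' := y + _ in bp.
have [Ub Un] := netU.
have [p Up pp] := Un _ bp; have [q Uq qq] := Un _ bq.
have ST : 0 < S + T - 1 by lra.
(* Parameter on the chord from [p'] to [q'] of the point with parameter [u] between [x] and [y]: in
   units of [|y - x|] the chord has length [S + T - 1], and [x] is at distance [S - 1] from [p']. *)
pose w u : R := (S - 1 + u) / (S + T - 1).
have w01 u : 0 <= u <= 1 -> 0 <= w u <= 1.
  move=> /andP[u0 u1]; rewrite divr_ge0 ?(ltW ST) ?ler_pdivrMr//; lra.
have wE u : (1 - u) *: x + u *: y = p' + w u *: (q' - p').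
  by apply/rowP => l; rewrite !mxE /w; field; rewrite gt_eqF.
have w_le u v : u <= v -> w u <= w v.
  by move=> uv; rewrite ler_wpM2r ?invr_ge0 ?(ltW ST)// lerD2l.
pose n u := Num.truncn (w u * enorm (q - p) / eps).
have n_le u v : u <= v -> (n u <= n v)%N.
  move=> uv; apply: le_truncn; rewrite ler_wpM2r ?invr_ge0 ?(ltW eps0)//.
  by rewrite ler_wpM2r ?enorm_ge0// w_le.
have near u : 0 <= u <= 1 -> enorm ((1 - u) *: x + u *: y - gridpt p q (n u))
    <= 2 * eps.
  by move=> u01; rewrite wE gridpt_near// w01.
have mem u : 0 <= u <= 1 -> grid eps p q (gridpt p q (n u)) /\ X (gridpt p q (n u)).
  by move=> u01; have [] := gridpt_mem Up Uq (w01 _ u01).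
have i0 : 0 <= (0 : R) <= 1 by rewrite lexx ler01.
have i1 : 0 <= (1 : R) <= 1 by rewrite lexx ler01.
have [s [/andP[s0 s1] zE gz]] : exists s, [/\ 0 <= s <= 1,
   gridpt p q (n t) = (1 - s) *: gridpt p q (n 0) + s *: gridpt p q (n 1) &
   valL_ 0 g (gridpt p q (n t)) <= (1 - s) * valL_ 0 g (gridpt p q (n 0)) + s *
       valL_ 0 g (gridpt p q (n 1))].
  have := n_le 0 1 ler01; rewrite leq_eqVlt => /orP[/eqP n01|n01].
    (* When both ends round to the same grid point, monotonicity of [n] forces the middle one there
       too, and [s = 0] works trivially. *)
    have nt : n t = n 1.
      by apply/eqP; rewrite eqn_leq n_le//= -n01 n_le.
    exists 0; rewrite nt n01 subr0 scale1r scale0r addr0 mul1r mul0r addr0;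
        split=> //.
  have [G0 X0] := mem _ i0; have [G1 X1] := mem _ i1; have [Gt Xt] := mem _ t01.
  apply: gridpt_convex => //; last by rewrite !n_le.
  (* If [p = q], all indices are 0, against [n 0 < n 1]. *)
  move=> pq; move: n01; rewrite /n pq subrr enorm0 !mulr0 mul0r.
  by rewrite ltnn.
have := near _ i0; rewrite subr0 scale1r scale0r addr0 => near0.
have := near _ i1; rewrite subrr scale1r scale0r add0r => near1.
have neart := near _ t01.
have [[_ X0] [[_ X1] [_ Xt]]] := (mem _ i0, (mem _ i1, mem _ t01)).
have X_t := convX domX Xx Xy t01.
have h1 := gL' _ _ X_t Xt.
have h2 := gL' _ _ X0 Xx; rewrite enormBC in h2.
have h3 := gL' _ _ X1 Xy; rewrite enormBC in h3.
(* Rounding changes the weight [t] into [s]. Since each of the three points moves by at most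
   [2 * eps], [|s - t| |y - x|] is at most [4 * eps], and the Lipschitz bound concludes. *)
have h5 : (s - t) * (valL_ 0 g y - valL_ 0 g x) <= gamma * (4 * eps).
  have hs : `|s - t| * enorm (y - x) <= 4 * eps.
    rewrite -enormZ.
    have -> : (s - t) *: (y - x) =
       ((1 - s) *: (x - gridpt p q (n 0)) + s *: (y - gridpt p q (n 1)))
       - ((1 - t) *: x + t *: y - gridpt p q (n t)).
      by rewrite zE; apply/rowP => l; rewrite !mxE; ring.
    rewrite (le_trans (enormD _ _))// enormN (le_trans (lerD (enormD _ _) neart))//.
    rewrite !enormZ !ger0_norm ?subr_ge0//.
    set A := enorm _ in near0 *; set B := enorm _ in near1 *; nra.
  rewrite (le_trans (ler_norm _))// normrM.
  have : `|valL_ 0 g y - valL_ 0 g x| <= gamma * enorm (y - x).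
    have := gL' _ _ Xx Xy; have := gL' _ _ Xy Xx.
    by rewrite (enormBC x y) ler_norml; lra.
  move=> /(ler_wpM2l (normr_ge0 (s - t)))/le_trans; apply.
  by rewrite mulrCA ler_wpM2l.
have e1 := ler_wpM2l gamma0 near0.
have e2 := ler_wpM2l gamma0 near1.
have e3 := ler_wpM2l gamma0 neart.
have k1 : (1 - s) * valL_ 0 g (gridpt p q (n 0)) <= (1 - s) * (valL_ 0 g x +
    gamma * (2 * eps)).
  by rewrite ler_wpM2l ?subr_ge0//; lra.
have k2 : s * valL_ 0 g (gridpt p q (n 1)) <= s * (valL_ 0 g y + gamma * (2 * eps)).
  by rewrite ler_wpM2l//; lra.
lra.
Qed.

End ApproximateConvexity.

(** * Approximate Jensen inequality and Caratheodory's theorem with a cost *)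

Section ConvexCombinations.
Context {R : realType} {d : nat}.
Implicit Types (X : set 'rV[R]_d) (c : 'rV[R]_d -> R).

Definition weights n (l : 'I_n -> R) := (forall i, 0 <= l i) /\ \sum_i l i = 1.

Definition approx_convex X (K : R) c := forall x y t, X x -> X y -> 0 <= t <= 1 ->
  c ((1 - t) *: x + t *: y) <= (1 - t) * c x + t * c y + K.

(** Induction: splitting off the first point and renormalising the remaining weights costs one
    [K]. *)
Lemma approx_jensen X K c (domX : bounded_convex_domain X) : 0 <= K ->
    approx_convex X K c ->
  forall n (l : 'I_n.+1 -> R) (y : 'I_n.+1 -> 'rV[R]_d), weights l -> (forall
      i, X (y i)) ->
  X (\sum_i l i *: y i) /\ c (\sum_i l i *: y i) <= \sum_i l i * c (y i) + n%:R * K.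
Proof.
move=> K0 cK; elim=> [|n IHn] l y [l0 l1] Xy.
  by move: l1; rewrite !big_ord1 => ->; rewrite scale1r !mul1r mul0r addr0.
move: l1; rewrite !(big_ord_recl n.+1); set a := l ord0 => l1.
have {l1}l1 : \sum_(i < n.+1) l (lift ord0 i) = 1 - a by rewrite -l1 addrC addKr.
have a0 : 0 <= a := l0 _.
have a1 : 0 <= 1 - a by rewrite -l1 sumr_ge0.
(* All the weight sits on the first point, and the other weights cannot be renormalised. *)
have [a_1|a_1] := eqVneq (1 - a) 0.
  have z i : l (lift ord0 i) = 0.
    move/eqP: l1; rewrite a_1 psumr_eq0//= => /allP/(_ i (mem_index_enum i))/eqP//.
  rewrite !big1 => [|i _|i _]; rewrite ?z ?scale0r ?mul0r//.
  have -> : a = 1 by apply/eqP; rewrite -subr_eq0 -opprB a_1 oppr0.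
  by rewrite scale1r mul1r !addr0 lerDl mulr_ge0.
have ap : 0 < 1 - a by rewrite lt_neqAle eq_sym a_1.
pose w i := l (lift ord0 i) / (1 - a).
have ww : weights w.
  by split=> [i|]; [rewrite divr_ge0|rewrite -mulr_suml l1 divff].
have := IHn w (fun i => y (lift ord0 i)) ww (fun i => Xy _).
set z := \sum_i _ => -[Xz cz].
have -> : \sum_(i < n.+1) l (lift ord0 i) *: y (lift ord0 i) = (1 - a) *: z.
  rewrite scaler_sumr; apply: eq_bigr => i _.
  by rewrite scalerA /w mulrC divfK.
have t01 : 0 <= 1 - a <= 1 by rewrite a1 lerBlDr lerDl.
have := convX domX (Xy ord0) Xz t01; have := cK _ _ _ (Xy ord0) Xz t01.
rewrite subKr => h Xs; split=> //; apply: (le_trans h).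
have -> : \sum_(i < n.+1) l (lift ord0 i) * c (y (lift ord0 i)) =
   (1 - a) * (\sum_i w i * c (y (lift ord0 i))).
  rewrite mulr_sumr; apply: eq_bigr => i _.
  by rewrite mulrA /w [_ * (_ / _)]mulrC divfK.
have h2 := ler_wpM2l a1 cz.
have h3 : (1 - a) * (n%:R * K) <= n%:R * K.
  by rewrite ler_piMl ?mulr_ge0// lerBlDr lerDl.
by rewrite -natr1; lra.
Qed.

(* The weights can be moved along an affine dependency of the points, in the
   direction that does not increase the cost, until one of them vanishes. *)
Lemma caratheodory_step c n (l : 'I_n -> R) (y : 'I_n -> 'rV[R]_d) : (d.+1 < n)%N ->
  weights l -> exists l' : 'I_n -> R,
  [/\ weights l', \sum_i l' i *: y i = \sum_i l i *: y i,
    \sum_i l' i * c (y i) <= \sum_i l i * c (y i) & exists j, l' j = 0].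
Proof.
move=> dn [l0 l1].
(* With a 1 appended to each point, the left kernel of [A] consists of the affine dependencies; it
   is nonzero because [A] has more than [d + 1] rows. *)
pose A : 'M[R]_(n, d + 1) := row_mx (\matrix_(i, j) y i ord0 j) (const_mx 1).
have [m [m0 mA mc]] : exists m : 'rV[R]_n,
    [/\ m != 0, m *m A = 0 & \sum_i m ord0 i * c (y i) <= 0].
  have /rowV0Pn[m /sub_kermxP mA m0] : kermx A != 0.
    rewrite -mxrank_eq0 mxrank_ker subn_eq0 -ltnNge.
    by rewrite (leq_ltn_trans (rank_leq_col _))// addn1.
  have [mc|mc] := leP (\sum_i m ord0 i * c (y i)) 0; first by exists m.
  exists (- m); rewrite oppr_eq0 mulNmx mA oppr0; split=> //.
  under eq_bigr do rewrite mxE mulNr.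
  by rewrite sumrN oppr_le0 ltW.
move: mA; rewrite mul_mx_row -row_mx0 => /eq_row_mx[mY m1].
have sm : \sum_i m ord0 i = 0.
  have /rowP/(_ ord0) := m1; rewrite !mxE => h; rewrite -[RHS]h.
  by apply: eq_bigr => i _; rewrite mxE mulr1.
have sy : \sum_i m ord0 i *: y i = 0.
  rewrite -[RHS]mY; apply/rowP => j; rewrite summxE mxE.
  by apply: eq_bigr => i _; rewrite !mxE.
have [k mk] : exists k, m ord0 k < 0.
  apply/existsP; apply: contraT => /existsPn nm.
  case/negP: m0; apply/eqP/rowP => i; rewrite mxE.
  have m_ge0 j : 0 <= m ord0 j by rewrite leNgt nm.
  move/eqP: sm; rewrite psumr_eq0//= => /allP/(_ i (mem_index_enum i))/eqP//.
(* The least of these ratios over the negative coordinates of [m] is the longest step that keeps all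
   weights nonnegative. *)
pose r i := l i / - m ord0 i.
have [j mj jmin] := @Order.TotalTheory.arg_minP _ _ _ k (fun i => m ord0 i < 0)
    r mk.
pose l' i := l i + r j * m ord0 i.
have rj0 : 0 <= r j by rewrite divr_ge0 ?oppr_ge0 ?(ltW mj).
exists l'; split.
- split=> [i|]; last by rewrite big_split/= l1 -mulr_sumr sm mulr0 addr0.
  rewrite /l'; have [mi|mi] := leP 0 (m ord0 i).
    by rewrite addr_ge0// mulr_ge0.
  have := jmin i mi; rewrite {2}/r ler_pdivlMr ?oppr_gt0//; lra.
- under eq_bigr do rewrite scalerDl -scalerA.
  by rewrite big_split/= -scaler_sumr sy scaler0 addr0.
- under eq_bigr do rewrite mulrDl -mulrA.
  by rewrite big_split/= -mulr_sumr gerDl mulr_ge0_le0.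
- exists j; rewrite /l' /r; field; exact: ltr0_neq0.
Qed.

(** As long as more than [d + 1] points remain, a point whose weight has been brought to zero is
    dropped; [s] records the points kept. *)
Lemma caratheodory c n (l : 'I_n.+1 -> R) (y : 'I_n.+1 -> 'rV[R]_d) : weights l ->
  exists m (l' : 'I_m.+1 -> R) (s : 'I_m.+1 -> 'I_n.+1),
  [/\ (m <= d)%N, weights l', \sum_i l' i *: y (s i) = \sum_i l i *: y i &
    \sum_i l' i * c (y (s i)) <= \sum_i l i * c (y i)].
Proof.
elim: n l y => [|n IHn] l y lw; first by exists 0%N, l, id; split.
have [nd|dn] := leqP n.+1 d; first by exists n.+1, l, id; split.
have [|l1 [[l10 l11] l1y l1c [j l1j]]] := @caratheodory_step c _ l y _ lw;
    first by rewrite ltnS.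
have [|m [l' [s [md lw' l'y l'c]]]] := IHn (fun i => l1 (lift j i)) (fun i => y
    (lift j i)).
  by split=> //; rewrite -l11 [RHS](bigD1_ord j)//= l1j add0r.
exists m, l', (fun i => lift j (s i)); split=> //.
  by rewrite l'y -l1y [RHS](bigD1_ord j)//= l1j scale0r add0r.
rewrite (le_trans l'c)// (le_trans _ l1c)//.
by rewrite [leRHS](bigD1_ord j)//= l1j mul0r add0r.
Qed.

(** Reducing to at most [d + 1] points first makes the error independent of [n]. *)
Lemma approx_jensen_dim X K c n (l : 'I_n.+1 -> R) (y : 'I_n.+1 -> 'rV[R]_d) :
  bounded_convex_domain X -> 0 <= K -> approx_convex X K c ->
  weights l -> (forall i, X (y i)) ->
  X (\sum_i l i *: y i) /\ c (\sum_i l i *: y i) <= \sum_i l i * c (y i) + d%:R * K.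
Proof.
move=> domX K0 cK lw Xy.
have [m [l' [s [md lw' <- l'c]]]] := caratheodory c y lw.
have [Xz h] := approx_jensen domX K0 cK lw' (fun i => Xy (s i)).
split=> //; rewrite (le_trans h)// lerD// ler_wpM2r// ler_nat//.
Qed.

End ConvexCombinations.

(** * The convex Lipschitz envelope *)

Section Envelope.
Context {R : realType} {d : nat} {X : set 'rV[R]_d}.
Hypothesis domX : bounded_convex_domain X.
Variables (c : 'rV[R]_d -> R) (gamma K : R).
Hypotheses (gamma0 : 0 <= gamma) (K0 : 0 <= K) (cK : approx_convex X K c).
Hypothesis (cL : forall x y, X x -> X y -> c x <= c y + gamma * enorm (x - y)).
Implicit Types (x y z : 'rV[R]_d).

(** The number of points is left free, so that a mixture of two combinations is again admissible. *)
Definition envelope_set x : set R :=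
  [set v | exists n (l : 'I_n.+1 -> R) (y : 'I_n.+1 -> 'rV[R]_d),
    [/\ weights l, forall i, X (y i) &
     v = \sum_i l i * c (y i) + gamma * enorm (x - \sum_i l i *: y i)]].

Definition envelope x := inf (envelope_set x).

(** The Lipschitz bound compares [c x] with the value at the barycentre, where the approximate
    Jensen inequality applies. *)
Lemma envelope_set_lb x : X x -> lbound (envelope_set x) (c x - d%:R * K).
Proof.
move=> Xx _ [n [l [y [lw Xy ->]]]].
have [Xz h] := approx_jensen_dim domX K0 cK lw Xy.
by have := cL Xx Xz; lra.
Qed.

Lemma envelope_set_self x : X x -> envelope_set x (c x).
Proof.
move=> Xx; exists 0%N, (fun=> 1), (fun=> x); split=> //.
  by split=> //; rewrite big_ord1.
by rewrite !big_ord1 scale1r subrr enorm0 mulr0 addr0 mul1r.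
Qed.

Lemma has_inf_envelope x : X x -> has_inf (envelope_set x).
Proof.
move=> Xx; split; first by exists (c x); exact: envelope_set_self.
by exists (c x - d%:R * K); exact: envelope_set_lb.
Qed.

Lemma envelope_le x : X x -> envelope x <= c x.
Proof.
by move=> Xx; apply: ge_inf; [have [] := has_inf_envelope Xx|exact:
    envelope_set_self].
Qed.

Lemma envelope_ge x : X x -> c x - d%:R * K <= envelope x.
Proof.
by move=> Xx; apply: lb_le_inf; [have [] := has_inf_envelope Xx|exact:
    envelope_set_lb].
Qed.

(** A combination used at [y] also serves at [x]; only the distance penalty changes. *)
Lemma envelope_lip x y : X x -> X y -> envelope x <= envelope y + gamma * enorm
    (x - y).
Proof.
move=> Xx Xy; rewrite -lerBlDr; apply: lb_le_inf; first by have [] :=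
    has_inf_envelope Xy.
move=> _ [n [l [z [lw Xz ->]]]]; rewrite lerBlDr.
apply: (@le_trans _ _ (\sum_i l i * c (z i) + gamma * enorm (x - \sum_i l i *:
    z i))).
  by apply: ge_inf; [have [] := has_inf_envelope Xx|exists n, l, z].
by rewrite -addrA lerD2l -mulrDr ler_wpM2l// (le_trans (enorm_triangle y _
    _))// [leLHS]addrC.
Qed.

(** Nearly optimal combinations for [x] and [y] are concatenated with weights scaled by [1 - t] and
    [t]; the penalty is controlled by convexity of the norm. *)
Lemma envelope_convex x y t : X x -> X y -> 0 <= t <= 1 ->
  envelope ((1 - t) *: x + t *: y) <= (1 - t) * envelope x + t * envelope y.
Proof.
move=> Xx Xy t01; have /andP[t0 t1] := t01; have t1' : 0 <= 1 - t by rewrite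
    subr_ge0.
have Xz := convX domX Xx Xy t01.
apply/ler_addgt0Pr => e e0.
have [_ [n [l [u [[l0 l1] Xu ->]]]] he] := inf_adherent e0 (has_inf_envelope Xx).
have [_ [m [k [v [[k0 k1] Xv ->]]]] hf] := inf_adherent e0 (has_inf_envelope Xy).
rewrite -/(envelope x) in he; rewrite -/(envelope y) in hf.
pose w (i : 'I_(n.+1 + m.+1)) := match fintype.split i with inl i => (1 - t) *
    l i | inr i => t * k i end.
pose s (i : 'I_(n.+1 + m.+1)) := match fintype.split i with inl i => u i | inr
    i => v i end.
have wl i : w (lshift _ i) = (1 - t) * l i by rewrite /w (unsplitK (inl i)).
have wr i : w (rshift _ i) = t * k i by rewrite /w (unsplitK (inr i)).
have sl i : s (lshift _ i) = u i by rewrite /s (unsplitK (inl i)).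
have sr i : s (rshift _ i) = v i by rewrite /s (unsplitK (inr i)).
have ww : weights w.
  split=> [i|]; first by rewrite /w; case: (fintype.split i) => j; rewrite mulr_ge0.
  rewrite big_split_ord/=; under eq_bigr do rewrite wl.
  under [X in _ + X]eq_bigr do rewrite wr.
  by rewrite -!mulr_sumr l1 k1 !mulr1 subrK.
have Xs i : X (s i) by rewrite /s; case: (fintype.split i).
have ws : \sum_i w i *: s i = (1 - t) *: (\sum_i l i *: u i) + t *: (\sum_i k i
    *: v i).
  rewrite big_split_ord/= !scaler_sumr; congr (_ + _); apply: eq_bigr => i _.
    by rewrite wl sl scalerA.
  by rewrite wr sr scalerA.
have wc : \sum_i w i * c (s i) = (1 - t) * (\sum_i l i * c (u i)) + t * (\sum_i
    k i * c (v i)).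
  rewrite big_split_ord/= !mulr_sumr; congr (_ + _); apply: eq_bigr => i _.
    by rewrite wl sl mulrA.
  by rewrite wr sr mulrA.
apply: (@le_trans _ _ (\sum_i w i * c (s i) +
    gamma * enorm ((1 - t) *: x + t *: y - \sum_i w i *: s i))).
  by apply: ge_inf; [have [] := has_inf_envelope Xz|exists (n + m.+1)%N, w, s].
rewrite wc ws opprD addrACA -!scalerBr.
have := ler_wpM2l gamma0 (enormD ((1 - t) *: (x - \sum_i l i *: u i)) (t *: (y
    - \sum_i k i *: v i))).
rewrite !enormZ !ger0_norm//.
have := ler_wpM2l t1' (ltW he); have := ler_wpM2l t0 (ltW hf); lra.
Qed.

End Envelope.

(** * Locality of differentiability and gradients of quadratics *)

Lemma near_eq_differentiable (R : numFieldType) (V W : normedModType R)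
    (f g : V -> W) (x : V) :
  (\near x, f x = g x) -> differentiable f x -> differentiable g x.
Proof.
move=> fg df.
have gx : g x = f x by rewrite (nbhs_singleton fg).
apply/diffP => /=.
apply: (@getPex _ (fun (df : {linear V -> W}) => continuous df /\
  forall y, g y = g (lim (nbhs x)) + df (y - lim (nbhs x))
                  +o_(y \near x) (y - lim (nbhs x)))).
(* The differential of [f] serves for [g], since the values at [x] agree and the remainder condition
   is local. *)
exists ('d f x); split; first exact: diff_continuous.
suff : g = (fun y => g (lim (nbhs x)) + 'd f x (y - lim (nbhs x)))
    +o_x (fun y => y - lim (nbhs x)) by rewrite funeqE.
have [_ ] := (diffP _ _).1 df.
have : f = (fun y => f (lim (nbhs x)) + 'd f x (y - lim (nbhs x)))
    +o_x (fun y => y - lim (nbhs x)) by rewrite funeqE; case/diffP: df.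
move=> /eqaddoP h _; apply/eqaddoP => e e0.
have := h e e0; apply: filterS2 fg => y; rewrite lim_id// gx.
by rewrite /GRing.add/= /GRing.opp/= => ->.
Qed.

Section Differentiation.
Context {R : realType} {d : nat}.
Implicit Types (x v a c : 'rV[R]_d).

Lemma is_derive_coord x v i :
  is_derive x v (fun y : 'rV[R]_d => y ord0 i) (v ord0 i).
Proof.
apply: DeriveDef; first exact/diff_derivable/differentiable_coord.
have := @derive_mx _ _ _ _ (id : 'rV[R]_d -> 'rV[R]_d) x v (@derivable_id _ _ x v).
by rewrite derive_id => /matrixP/(_ ord0 i); rewrite mxE => <-.
Qed.

Lemma dotv_delta v i : dotv v (delta_mx ord0 i) = v ord0 i.
Proof.
rewrite /dotv (bigD1 i)//= mxE !eqxx mulr1 big1 ?addr0// => j ji.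
by rewrite mxE eqxx (negbTE ji) mulr0.
Qed.

Lemma derive_grad (f : 'rV[R]_d -> R) x v : differentiable f x ->
  'D_v f x = dotv (\row_i 'D_(delta_mx ord0 i) f x) v.
Proof.
move=> df; rewrite deriveE// {1}(row_sum_delta v) linear_sum.
by apply: eq_bigr => i _; rewrite linearZ mxE deriveE// mulrC.
Qed.

Definition quadratic a b c : 'rV[R]_d -> R :=
  fun y => dotv a y + b + enorm (y - c) ^+ 2.

(** As a sum of functions of one coordinate each, the quadratic falls under the rules for sums and
    powers. *)
Lemma quadraticE a b c : quadratic a b c =
  \sum_(i < d) (a ord0 i *: (fun y : 'rV[R]_d => y ord0 i) +
    ((fun y : 'rV[R]_d => y ord0 i) - cst (c ord0 i)) ^+ 2) + cst b.
Proof.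
apply/funext => y; rewrite /quadratic sqr_enorm addrAC.
rewrite [RHS](_ : _ = (\sum_(i < d) (a ord0 i * y ord0 i + (y ord0 i - c ord0
    i) ^+ 2)) + b).
  by rewrite big_split/=; congr (_ + _ + _); apply: eq_bigr => i _; rewrite
      !mxE expr2.
by rewrite [LHS]/GRing.add /= fct_sumE.
Qed.

Lemma differentiable_quadratic a b c x : differentiable (quadratic a b c) x.
Proof.
rewrite quadraticE; apply: differentiableD; last exact: differentiable_cst.
apply: differentiable_sum => i; apply: differentiableD.
  exact/differentiableZ/differentiable_coord.
apply/differentiableX/differentiableB; last exact: differentiable_cst.
exact: differentiable_coord.
Qed.

Lemma derive_quadratic a b c x i :
  'D_(delta_mx ord0 i) (quadratic a b c) x = a ord0 i + 2 * (x - c) ord0 i.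
Proof.
set v := delta_mx _ _; rewrite quadraticE.
have -> : a ord0 i + 2 * (x - c) ord0 i = dotv (a + 2 *: (x - c)) v + 0.
  by rewrite dotv_delta !mxE addr0.
have hF j : is_derive x v (a ord0 j *: (fun y : 'rV[R]_d => y ord0 j) +
    ((fun y : 'rV[R]_d => y ord0 j) - cst (c ord0 j)) ^+ 2)
    ((a + 2 *: (x - c)) ord0 j * v ord0 j).
  have h := is_derive_coord x v j.
  apply: (is_derive_eq (is_deriveD (is_deriveZ (a ord0 j) h)
    (is_deriveX 2 (is_deriveB h (is_derive_cst (c ord0 j) x v))))).
  rewrite /GRing.scale/= !mxE /= expr1 subr0.
  by rewrite [X in 2 * X](_ : _ = x ord0 j - c ord0 j)//; ring.
exact: (@derive_val _ _ _ _ _ _ _ (is_deriveD (is_derive_sum hF) (is_derive_cst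
    b x v))).
Qed.

End Differentiation.

(** * First-order Taylor bound and gradients of mixtures *)

Section Taylor.
Context {R : realType} {d : nat} {X : set 'rV[R]_d}.
Hypothesis domX : bounded_convex_domain X.
Implicit Types (x v p : 'rV[R]_d) (f g : X -> R).

(** Contracting a ball around [x] towards [y] by the factor [1 - c] gives a ball inside [X], by
    convexity. *)
Lemma interior_segment x y c : X° x -> X y -> 0 <= c < 1 -> X° (x + c *: (y - x)).
Proof.
move=> /interior_enorm[r r0 rX] Xy /andP[c0 c1].
have c1' : 0 < 1 - c by rewrite subr_gt0.
apply: (@enorm_interior _ _ _ _ (r * (1 - c))); first by rewrite mulr_gt0.
move=> z; set p := x + _ => zp.
have -> : z = (1 - c) *: (x + (1 - c)^-1 *: (z - p)) + c *: y.
  by apply/rowP => k; rewrite /p !mxE; field; rewrite gt_eqF.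
apply: (convX domX) => //; last by rewrite c0 ltW.
apply: rX; rewrite addrC addKr enormZ gtr0_norm ?invr_gt0// mulrC.
by rewrite ltr_pdivrMr.
Qed.

(** The mean value theorem along the segment turns the remainder into a difference of gradients at
    two interior points; [x] itself may lie on the boundary. *)
Lemma taylor_klip_grad k f x0 x : 0 <= k -> klip_grad k f -> continuous f -> X°
    x0 -> X x ->
  `|valL_ 0 f x - (valL_ 0 f x0 + dotv (grad f x0) (x - x0))| <= k * enorm (x -
      x0) ^+ 2.
Proof.
move=> k0 [df fk] cf Ix0 Xx; set v := x - x0; set F := valL_ 0 f.
have Xx0 := interior_subset Ix0.
pose phi (c : R) := F (x0 + c *: v).
have [c c01] : exists2 c, c \in `]0, 1[%R & phi 1 - phi 0 = 'D_v F (x0 + c *: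
    v) * (1 - 0).
  apply: (@MVT _ phi (fun c => 'D_v F (x0 + c *: v)) 0 1 ltr01).
    move=> c; rewrite in_itv/= => /andP[c0 c1].
    have Ic : X° (x0 + c *: v) by apply: interior_segment => //; rewrite ltW.
    (* The difference quotients of [phi] are those of [F] in the direction [v]. *)
    have quot : (fun h : R => h^-1 *: ((phi \o shift c) (h *: 1) - phi c)) =
        (fun h => h^-1 *: ((F \o shift (x0 + c *: v)) (h *: v) - F (x0 + c *: v))).
      apply/funext => h; congr (_ *: (F _ - _)).
      by rewrite /= scalerDl addrCA /GRing.scale/= mulr1.
    have dF : derivable F (x0 + c *: v) v by exact/diff_derivable/df.
    by apply: DeriveDef; [rewrite /derivable quot|rewrite /derive quot].
  (* At [c = 1] the point may be on the boundary, where the extension by 0 is continuous only within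
     [X]. *)
  apply/subspace_continuousP => c; rewrite /= in_itv/= => c01.
  have /subspace_continuousP/(_ (x0 + c *: v)) : {within X, continuous F}.
    by apply/(@subspace_valL_continuousP' _ X _ 0 f).
  have Xc : forall c, 0 <= c <= 1 -> X (x0 + c *: v).
    move=> u u01; have := convX domX Xx0 Xx u01; congr (X _).
    by apply/rowP => k'; rewrite !mxE; ring.
  move=> /(_ (Xc _ c01)) FX B /FX.
  rewrite /nbhs /= /within /= => nB.
  have lc : {for c, continuous (fun c : R => x0 + c *: v)}.
    by apply: continuousD; [exact: cvg_cst|apply: continuousZr_tmp; exact: cvg_id].
  have lcB : \near c, X (x0 + c *: v) -> B (F (x0 + c *: v)) := lc _ nB.
  apply: filterS lcB => u /= h; rewrite in_itv/= => u01.
  exact/h/Xc.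
move: c01; rewrite in_itv/= => /andP[c0 c1].
have x0v : x0 + v = x by rewrite addrC subrK.
rewrite /phi scale1r scale0r addr0 subr0 mulr1 x0v.
have Ic : X° (x0 + c *: v) by apply: interior_segment => //; rewrite ltW.
rewrite derive_grad; last exact: df.
rewrite -/(grad f _) opprD addrA => ->; rewrite -dotvBl.
rewrite (le_trans (norm_dotv_le _ _))//.
rewrite expr2 mulrA ler_wpM2r ?enorm_ge0//.
rewrite (le_trans (fk _ _ Ic Ix0))// ler_wpM2l//.
rewrite addrC addKr enormZ gtr0_norm// ler_piMl ?enorm_ge0//; exact: ltW.
Qed.

Definition quad_fun a b c : X -> R := fun x : X => quadratic a b c (set_val x).

Lemma valL_comb (s t : R) f g : valL_ 0 (s *: f + t *: g) = s *: valL_ 0 f + t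
    *: valL_ 0 g.
Proof.
apply/funext => x.
rewrite (_ : (s *: valL_ 0 f + t *: valL_ 0 g) x = s * valL_ 0 f x + t * valL_
    0 g x)//.
have [/setX_val[x' <-]|Xx] := pselect (X x); first by rewrite !valL_val.
by rewrite !valL_out// !mulr0 addr0.
Qed.

Lemma near_quad_fun a b c x : X° x -> \near x, quadratic a b c x = valL_ 0
    (quad_fun a b c) x.
Proof.
by move=> /filterS; apply => y /setX_val[y' <-]; rewrite valL_val.
Qed.

(** In the interior the quadratic has the 2-Lipschitz gradient [a + 2 *: (x - c)], and gradients
    combine linearly. *)
Lemma klip_grad_comb k f a b c t : 0 <= t <= 1 -> klip_grad k f ->
  klip_grad ((1 - t) * k + 2 * t) ((1 - t) *: f + t *: quad_fun a b c).
Proof.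
move=> /andP[t0 t1] [df fk].
have dq x : X° x -> differentiable (valL_ 0 (quad_fun a b c)) x.
  by move=> Ix; apply: near_eq_differentiable (near_quad_fun a b c Ix)
      (differentiable_quadratic _ _ _ _).
have gq x : X° x -> grad (quad_fun a b c) x = a + 2 *: (x - c).
  move=> Ix; apply/rowP => i; rewrite mxE.
  rewrite -(near_eq_derive _ (near_quad_fun a b c Ix)) derive_quadratic.
  by rewrite !mxE.
split=> [x Ix|x y Ix Iy].
  rewrite valL_comb; apply: differentiableD; apply: differentiableZ; [exact:
      df|exact: dq].
have gE z : X° z -> grad ((1 - t) *: f + t *: quad_fun a b c) z =
    (1 - t) *: grad f z + t *: (a + 2 *: (z - c)).
  move=> Iz; rewrite -gq//; apply/rowP => i; rewrite !mxE valL_comb.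
  have d1 : derivable (valL_ 0 f) z (delta_mx ord0 i) by exact/diff_derivable/df.
  have d2 : derivable (valL_ 0 (quad_fun a b c)) z (delta_mx ord0 i) by
      exact/diff_derivable/dq.
  have d1' : derivable ((1 - t) \*: valL_ 0 f) z (delta_mx ord0 i) by exact:
      derivableZ.
  have d2' : derivable (t \*: valL_ 0 (quad_fun a b c)) z (delta_mx ord0 i) by
      exact: derivableZ.
  by rewrite (deriveD d1' d2') (deriveZ _ d1) (deriveZ _ d2).
rewrite !gE//.
have -> : (1 - t) *: grad f x + t *: (a + 2 *: (x - c)) -
   ((1 - t) *: grad f y + t *: (a + 2 *: (y - c))) =
   (1 - t) *: (grad f x - grad f y) + (2 * t) *: (x - y).
  by apply/rowP => i; rewrite !mxE; ring.
rewrite (le_trans (enormD _ _))// !enormZ !ger0_norm ?subr_ge0 ?mulr_ge0//.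
by rewrite [leRHS]mulrDl lerD// -mulrA ler_wpM2l ?subr_ge0// fk.
Qed.

End Taylor.

(** * Interpolation of mixtures with a quadratic *)

Section Interpolation.
Context {R : realType} {d : nat} {X : set 'rV[R]_d} {eps : R} {U : set 'rV[R]_d}.
Context {E : set (X -> R)} {I : (X -> R) -> X -> R} {CI delta : R}.
Hypotheses (domX : bounded_convex_domain X) (eps0 : 0 < eps).
Hypothesis opI : interpolation_operator E I CI delta.
Implicit Types (f g : X -> R) (a c : 'rV[R]_d).

Lemma Cb_comb (s t : R) f g : Cb X f -> Cb X g -> Cb X (s *: f + t *: g).
Proof.
move=> [cf [M [_ fM]]] [cg [N [_ gN]]]; split.
  move=> x; apply: continuousD; apply: continuousZl_tmp; [exact: cf|exact: cg].
have fM' : forall x, `|f x| <= M + 1 by move=> x; apply: (fM (M + 1)) => //;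
    rewrite ltrDl.
have gN' : forall x, `|g x| <= N + 1 by move=> x; apply: (gN (N + 1)) => //;
    rewrite ltrDl.
exists (`|s| * (M + 1) + `|t| * (N + 1)); split; first exact: num_real.
move=> K /ltW sK x _; apply: le_trans sK; rewrite /=.
rewrite (_ : (s *: f + t *: g) x = s * f x + t * g x)//.
by rewrite (le_trans (ler_normD _ _))// !normrM lerD// ler_wpM2l.
Qed.

(** The last term measures the strict convexity of the squared norm and is the source of the margin
    in the constraints. *)
Lemma enorm_comb_sqr (u v c : 'rV[R]_d) t :
  enorm (u + t *: (v - u) - c) ^+ 2 = (1 - t) * enorm (u - c) ^+ 2 + t * enorm
      (v - c) ^+ 2
    - t * (1 - t) * enorm (u - v) ^+ 2.
Proof.
rewrite (_ : u + _ - c = (1 - t) *: (u - c) + t *: (v - c)); last first.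
  by apply/rowP => i; rewrite !mxE; ring.
rewrite (_ : u - v = (u - c) - (v - c)); last by rewrite opprB addrA subrK.
move: (u - c) (v - c) => p q.
rewrite !sqr_enorm dotvBl !dotvBr !dotvDl !dotvDr !dotvZl !dotvZr (dotvC q p).
by ring.
Qed.

Lemma grid_separated (p q x y : 'rV[R]_d) : grid eps p q x -> grid eps p q y ->
    x <> y ->
  eps <= enorm (x - y).
Proof.
move=> [i _ <-] [j _ <-] xy.
have [pq|pq] := eqVneq (q - p) 0.
  by case: xy; rewrite pq !scaler0.
have np := enorm_gt0 pq.
rewrite opprD addrACA subrr add0r -scalerBl -mulrBl -mulrBr enormZ.
rewrite !normrM normfV (gtr0_norm np) divfK ?gt_eqF// gtr0_norm// ler_peMr
    ?(ltW eps0)//.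
have ij : i <> j by move=> ij; apply: xy; rewrite ij.
have [ij'|ij'|//] := ltngtP i j; first rewrite distrC.
  by rewrite -natrB ?(ltnW ij')// normr_nat ler1n subn_gt0.
by rewrite -natrB ?(ltnW ij')// normr_nat ler1n subn_gt0.
Qed.

Lemma affine_Hcons a b : Hcons (Mconstr X eps U) (affine_fun a b : X -> R).
Proof.
split; first exact/(interp_sub opI)/(interp_affine opI).
move=> _ [p [q [x [y [z [_ _ xy [t t01 zE] ->]]]]]].
move: t01; rewrite /= in_itv/= => t01; rewrite (ell_affine_param _ xy t01 (esym
    zE)).
rewrite /affine_fun -!/(dotv _ _) -zE dotvDr dotvZr dotvBr.
by rewrite (_ : _ - _ = 0)//; ring.
Qed.

(* Strict convexity of the quadratic term, at scale [eps] on the grid,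
   absorbs the interpolation error [e]. *)
Lemma interp_Hcons f a b c t e :
  Hconv X f -> 0 <= t <= 1 -> 0 <= e ->
  let h := (1 - t) *: f + t *: quad_fun a b c in
  Cb X h -> (forall x, `|h x - I h x| <= e) -> 2 * e <= t * eps ^+ 2 ->
  Hcons (Mconstr X eps U) (I h).
Proof.
move=> [_ /(convex_functionP domX) cf] /andP[t0 t1] e0 h Ch he et.
split; first exact/(interp_sub opI)/(interp_range opI).
move=> _ [p [q [x [y [z [_ [Gx Gy Gz] xy [s s01 zE] ->]]]]]].
move: s01; rewrite /= in_itv/= => s01; have /andP[s0 s1] := s01.
rewrite (ell_affine_param _ xy s01 (esym zE)).
(* At an endpoint there is no margin, but [ell] vanishes identically. *)
have [sE|sn0] := eqVneq s 0.
  have -> : z = x by apply: set_val_inj; rewrite -zE sE scale0r addr0.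
  by rewrite sE subr0 mul1r mul0r subr0 subrr.
have [sE|sn1] := eqVneq s 1.
  have -> : z = y by apply: set_val_inj; rewrite -zE sE scale1r addrC subrK.
  by rewrite sE subrr mul1r mul0r subr0 subrr.
have sp : 0 < s by rewrite lt_neqAle eq_sym sn0.
have sq : 0 < 1 - s by rewrite subr_gt0 lt_neqAle sn1.
have nxy : set_val x <> set_val y by move=> /set_val_inj.
have vxy : set_val x - set_val y != 0 by rewrite subr_eq0; apply/eqP.
have xz : eps <= s * enorm (set_val x - set_val y).
  have -> : s * enorm (set_val x - set_val y) = enorm (set_val z - set_val x).
    by rewrite -zE [X in _ = enorm X]addrC addKr enormZ gtr0_norm// enormBC.
  apply: grid_separated Gz Gx _; rewrite -zE => /eqP; rewrite -subr_eq0 addrC addKr.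
  by rewrite scaler_eq0 (negbTE sn0) -opprB oppr_eq0 (negbTE vxy).
have zy : eps <= (1 - s) * enorm (set_val x - set_val y).
  have zyE : set_val z - set_val y = (1 - s) *: (set_val x - set_val y).
    by rewrite -zE; apply/rowP => i; rewrite !mxE; ring.
  have -> : (1 - s) * enorm (set_val x - set_val y) = enorm (set_val z - set_val y).
    by rewrite zyE enormZ gtr0_norm.
  apply: grid_separated Gz Gy _ => /eqP; rewrite -subr_eq0 zyE.
  by rewrite scaler_eq0 (negbTE vxy) orbF gt_eqF.
(* The product of the two distances from [z] to the endpoints, each at least [eps]. *)
have gap : eps ^+ 2 <= s * (1 - s) * enorm (set_val x - set_val y) ^+ 2.
  rewrite (_ : s * (1 - s) * _ = (s * enorm (set_val x - set_val y)) * ((1 - s)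
      * enorm (set_val x - set_val y))).
    by rewrite expr2 ler_pM ?(ltW eps0).
  by ring.
have fz : f z <= (1 - s) * f x + s * f y.
  by apply: cf => //; rewrite -zE; apply/rowP => i; rewrite !mxE; ring.
have hE w : h w = (1 - t) * f w + t * quad_fun a b c w by [].
have qz : quad_fun a b c z = (1 - s) * quad_fun a b c x + s * quad_fun a b c y
    - s * (1 - s) * enorm (set_val x - set_val y) ^+ 2.
  rewrite /quad_fun /quadratic -zE enorm_comb_sqr dotvDr dotvZr dotvBr.
  by ring.
have hz : h z <= (1 - s) * h x + s * h y - t * eps ^+ 2.
  rewrite !hE qz.
  have := ler_wpM2l t0 gap; have : (1 - t) * f z <= (1 - t) * ((1 - s) * f x +
      s * f y).
    by rewrite ler_wpM2l// subr_ge0.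
  by lra.
(* The error at [z] costs [e], those at [x] and [y] together [(1 - s) * e + s * e], whence the total
   [2 * e]. *)
have dz := he z; have dx := he x; have dy := he y.
move: dz dx dy; rewrite !ler_norml => /andP[z1 z2] /andP[x1 x2] /andP[y1 y2].
have ex : (1 - s) * h x <= (1 - s) * (I h x + e) by rewrite ler_wpM2l ?(ltW
    sq)//; lra.
have ey : s * h y <= s * (I h y + e) by rewrite ler_wpM2l//; lra.
by lra.
Qed.

(** The difference [f - h] is [t] times the difference between [f] and the quadratic, so mixing
    costs at most [t * r]. *)
Lemma interp_dist f a b c t e (x : X) r :
  let h := (1 - t) *: f + t *: quad_fun a b c in
  0 <= t -> `|h x - I h x| <= e -> `|f x - affine_fun a b x| + enorm (set_val x
      - c) ^+ 2 <= r ->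
  `|f x - I h x| <= t * r + e.
Proof.
move=> h t0 he fr.
have -> : f x - I h x = t * (f x - quad_fun a b c x) + (h x - I h x).
  rewrite (_ : h x = (1 - t) * f x + t * quad_fun a b c x)//; ring.
rewrite (le_trans (ler_normD _ _))// lerD// normrM ger0_norm// ler_wpM2l//.
rewrite (le_trans _ fr)//.
have -> : f x - quad_fun a b c x = (f x - affine_fun a b x) - enorm (set_val x
    - c) ^+ 2.
  by rewrite /quad_fun /quadratic opprD addrA.
by rewrite (le_trans (ler_normB _ _))// [X in _ + X]ger0_norm// sqr_ge0.
Qed.

Lemma interp_L2_le g L : 0 <= delta -> 0 <= L -> klip L g -> forall x, `|g x -
    I g x| <= delta * L.
Proof.
move=> delta0 L0 gL; apply/unorm_leP.
apply: (le_trans (interp_L2 opI (klip_Cb domX gL))).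
by rewrite EFinM; refine (lee_wpmul2l _ (klip_Lip_le L0 gL)); rewrite lee_fin.
Qed.

Lemma interp_L3_le g L : 0 <= L -> Cb X g -> klip_grad L g ->
  forall x, `|g x - I g x| <= delta ^+ 2 / 2 * L.
Proof.
move=> L0 Cg gL; apply/unorm_leP; apply: (le_trans (interp_L3 opI Cg)).
rewrite EFinM; refine (lee_wpmul2l _ (klip_grad_Lip_grad_le L0 gL)).
by rewrite lee_fin divr_ge0 ?sqr_ge0.
Qed.

Lemma interp_L1_klip g L : 0 <= CI -> 0 <= L -> klip L g -> klip (CI * L) (I g).
Proof.
move=> CI0 L0 gL; apply: Lip_le_klip.
apply: (le_trans (interp_L1 opI (klip_Cb domX gL))).
by rewrite EFinM; refine (lee_wpmul2l _ (klip_Lip_le L0 gL)); rewrite lee_fin.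
Qed.

(** Factor the difference of squares: the distances to [c] differ by at most [|x - y|] and sum to at
    most [2 * diam X]. *)
Lemma klip_quad_fun b (c : X) : klip (2 * diam X) (quad_fun 0 b (set_val c) : X
    -> R).
Proof.
move=> x y; rewrite /quad_fun /quadratic !dotv0l !add0r opprD addrACA subrr add0r.
set u := enorm (set_val x - _); set v := enorm (set_val y - _).
have uD : u <= diam X by apply: enorm_le_diam => //; exact: set_valX.
have vD : v <= diam X by apply: enorm_le_diam => //; exact: set_valX.
have uv : u <= enorm (set_val x - set_val y) + v by exact: enorm_triangle.
have vu : v <= enorm (set_val x - set_val y) + u.
  by rewrite (enormBC (set_val x)); exact: enorm_triangle.
have u0 : 0 <= u := enorm_ge0 _; have v0 : 0 <= v := enorm_ge0 _.
rewrite subr_sqr normrM mulrC ler_pM// ?normr_ge0//.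
  by rewrite ger0_norm ?addr_ge0//; lra.
by rewrite ler_norml; lra.
Qed.

(** * Bounds for the three directed distances *)

Lemma dH_Lip_convex gamma : 0 <= gamma -> boundary_net X eps U ->
  (dH (BLip X gamma `&` E `&` Hcons (Mconstr X eps U)) (BLip X gamma `&` Hconv X)
   <= (8 * d%:R * gamma * eps)%:E)%E.
Proof.
move=> gamma0 netU; apply: dH_le => [|f [[fL _] Hf]].
  by rewrite !mulr_ge0 ?(ltW eps0).
pose F := valL_ 0 f; pose K := 8 * gamma * eps.
have K0 : 0 <= K by rewrite !mulr_ge0 ?(ltW eps0).
have FK : approx_convex X K F.
  by move=> x y t Xx Xy t01; exact: (Hcons_approx_convex domX eps0 netU Hf
      gamma0 fL).
have FL x y : X x -> X y -> F x <= F y + gamma * enorm (x - y).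
  move=> /setX_val[x' <-] /setX_val[y' <-]; rewrite /F !valL_val.
  by have := fL x' y'; rewrite ler_norml; lra.
pose g (x : X) := envelope (X := X) F gamma (set_val x).
have gL : klip gamma g.
  move=> x y; have Xx := set_valX x; have Xy := set_valX y.
  have h1 := envelope_lip domX gamma0 K0 FK FL Xx Xy.
  have h2 := envelope_lip domX gamma0 K0 FK FL Xy Xx.
  by rewrite ler_norml /g; rewrite enormBC in h2; lra.
exists g.
  split=> //; split; first exact: klip_Cb gL.
  apply/(convex_functionP domX) => x y z t t01 zE; rewrite /g zE.
  exact: (envelope_convex domX gamma0 K0 FK FL (set_valX x) (set_valX y) t01).
move=> x; have Xx := set_valX x.
have h1 := envelope_le domX K0 FK FL Xx.
have h2 := envelope_ge domX K0 FK FL Xx.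
by rewrite -(valL_val f) -/F /g ger0_norm; rewrite /K in h2; lra.
Qed.

Lemma dH_convex_Lip gamma : 1 <= CI -> 0 < delta -> 2 * CI * diam X <= gamma ->
    eps <= diam X ->
  (dH (BLip X (gamma / CI) `&` Hconv X) (BLip X gamma `&` E `&` Hcons (Mconstr
      X eps U))
   <= (5 * (gamma ^+ 2 * delta / eps ^+ 2) * diam X)%:E)%E.
Proof.
move=> CI1 delta0 gammaD epsD; set D := diam X in gammaD epsD *.
have D0 : 0 < D by exact: lt_le_trans epsD.
have CI0 : 0 < CI by lra.
set L := gamma / CI.
have gammaE : gamma = CI * L by rewrite /L mulrC divfK ?gt_eqF.
(* The lower bound on [gamma] makes the quadratic [L]-Lipschitz; then so is the mixture [h], and its
   interpolant is [gamma]-Lipschitz. *)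
have DL : 2 * D <= L by rewrite /L ler_pdivlMr//; lra.
have L0 : 0 <= L by lra.
have Lg : L <= gamma by rewrite gammaE ler_peMl.
pose w := delta / eps ^+ 2.
have w0 : 0 < w by rewrite divr_gt0 ?exprn_gt0.
have deltaE : delta = w * eps ^+ 2 by rewrite /w divfK// gt_eqF ?exprn_gt0.
have deltaD : delta <= w * D ^+ 2.
  by rewrite deltaE ler_wpM2l ?(ltW w0)// ler_pXn2r ?nnegrE ?(ltW eps0) ?(ltW D0).
have wLLD : 0 <= w * L ^+ 2 * D.
  exact: (mulr_ge0 (mulr_ge0 (ltW w0) (sqr_ge0 L)) (ltW D0)).
(* Here 7/2 is 2 + 1 + 1/2: the distance to the constant, the squared distance to [x0], both
   multiplied by [t], and the interpolation error. *)
have bound r : r <= 7 / 2 * (w * L ^+ 2 * D) -> r <= 5 * (gamma ^+ 2 * delta /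
    eps ^+ 2) * D.
  move=> /le_trans; apply.
  have -> : gamma ^+ 2 * delta / eps ^+ 2 = w * gamma ^+ 2 by rewrite /w; ring.
  have : w * L ^+ 2 * D <= w * gamma ^+ 2 * D.
    rewrite ler_wpM2r ?(ltW D0)// ler_wpM2l ?(ltW w0)//.
    by rewrite ler_pXn2r ?nnegrE// (le_trans L0).
  have := wLLD.
  lra.
apply: dH_le => [|f [fL Hf]].
  by apply: bound; rewrite mulr_ge0 ?wLLD.
case: (domX) => _ _ _ [_ /interior_subset/setX_val[x0 _]].
have fx0 (x : X) : `|f x - affine_fun 0 (f x0) x| <= L * D.
  rewrite /affine_fun -/(dotv _ _) dotv0l add0r (le_trans (fL _ _))// ler_wpM2l//.
  by apply: enorm_le_diam => //; exact: set_valX.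
(* Chosen so that [t * eps ^+ 2] equals twice the interpolation error [delta * L]. *)
pose t := 2 * w * L.
have t0 : 0 <= t by rewrite mulr_ge0// mulr_ge0// ltW.
have [t1|t1] := leP t 1; last first.
  exists (affine_fun 0 (f x0)).
    split; last exact: affine_Hcons.
    split; last exact: (interp_affine opI).
    move=> x y; rewrite /affine_fun -!/(dotv _ _) !dotv0l subrr normr0.
    by rewrite mulr_ge0 ?enorm_ge0// (le_trans L0).
  move=> x; apply: bound; rewrite (le_trans (fx0 x))//.
  have : L * D <= t * (L * D) by exact: (ler_peMl (mulr_ge0 L0 (ltW D0)) (ltW t1)).
  have := wLLD.
  rewrite /t; lra.
have t01 : 0 <= t <= 1 by rewrite t0.
set h := (1 - t) *: f + t *: quad_fun 0 (f x0) (set_val x0).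
have hL : klip L h.
  move=> x y; set n := enorm _; have n0 : 0 <= n by exact: enorm_ge0.
  rewrite (_ : h x - h y = (1 - t) * (f x - f y) +
    t * (quad_fun 0 (f x0) (set_val x0) x - quad_fun 0 (f x0) (set_val x0) y));
        last first.
    rewrite (_ : h x = (1 - t) * f x + t * quad_fun 0 (f x0) (set_val x0) x)//.
    rewrite (_ : h y = (1 - t) * f y + t * quad_fun 0 (f x0) (set_val x0) y)//.
    by ring.
  have t1' : 0 <= 1 - t by rewrite subr_ge0.
  apply: (le_trans (ler_normD _ _)); rewrite (normrM (1 - t)) (normrM t)
      (ger0_norm t1') (ger0_norm t0).
  have f1 : (1 - t) * `|f x - f y| <= (1 - t) * (L * n).
    by rewrite ler_wpM2l ?subr_ge0//; exact: fL.
  have f2 := ler_wpM2l t0 (klip_quad_fun (f x0) x0 x y).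
  have f3 : t * (2 * D * n) <= t * (L * n) by rewrite !ler_wpM2l// ler_wpM2r.
  by apply: (le_trans (lerD f1 (le_trans f2 f3))); lra.
have he := interp_L2_le (ltW delta0) L0 hL.
exists (I h).
  split.
    split; first by rewrite /BLip /= gammaE; apply: interp_L1_klip => //;
        exact: ltW.
    exact/(interp_range opI)/klip_Cb/hL.
  apply: (interp_Hcons Hf t01 _ (klip_Cb domX hL) he).
    by rewrite mulr_ge0 ?(ltW delta0).
  by rewrite deltaE /t; lra.
move=> x; apply: bound.
have nD : enorm (set_val x - set_val x0) ^+ 2 <= D ^+ 2.
  rewrite ler_pXn2r ?nnegrE ?enorm_ge0 ?(ltW D0)//.
  by apply: enorm_le_diam => //; exact: set_valX.
apply: (le_trans (interp_dist t0 (he x) (lerD (fx0 x) nD))).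
have e1 : t * (L * D + D ^+ 2) <= t * (L * D + L / 2 * D).
  by rewrite ler_wpM2l// lerD2l expr2 ler_wpM2r ?(ltW D0)//; lra.
have e2 : delta * L <= w * D ^+ 2 * L by rewrite ler_wpM2r.
have e3 : w * D ^+ 2 * L <= w * (L / 2) * D * L.
  rewrite ler_wpM2r// -mulrA ler_wpM2l ?(ltW w0)// expr2 ler_wpM2r ?(ltW D0)//; lra.
by move: e1; rewrite /t; lra.
Qed.

Lemma dH_convex_C11 kappa : 0 < delta -> 1 <= kappa -> eps <= diam X ->
  (dH (BC11 X kappa `&` Hconv X) (E `&` Hcons (Mconstr X eps U))
   <= (5 * kappa ^+ 2 * diam X ^+ 2 * (delta ^+ 2 / eps ^+ 2))%:E)%E.
Proof.
move=> delta0 kappa1 epsD; set D := diam X in epsD *.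
have D0 : 0 < D by exact: lt_le_trans epsD.
have kappa0 : 0 <= kappa by lra.
set w := delta ^+ 2 / eps ^+ 2.
have w0 : 0 < w by rewrite divr_gt0 ?exprn_gt0.
have deltaE : delta ^+ 2 = w * eps ^+ 2 by rewrite /w divfK// gt_eqF ?exprn_gt0.
have deltaD : delta ^+ 2 <= w * D ^+ 2.
  by rewrite deltaE ler_wpM2l ?(ltW w0)// ler_pXn2r ?nnegrE ?(ltW eps0) ?(ltW D0).
have kk : kappa <= kappa ^+ 2 by rewrite expr2 ler_peMl.
have DDw : 0 <= D ^+ 2 * w by rewrite mulr_ge0 ?(ltW w0) ?sqr_ge0.
have kDw := ler_wpM2r DDw kk.
have k0Dw : 0 <= kappa * (D ^+ 2 * w) by rewrite mulr_ge0.
apply: dH_le => [|f [fk Hf]].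
  by lra.
have [[cf _] _] := Hf.
(* The tangent is taken at an interior point, where the gradient is controlled. *)
case: (domX) => _ _ _ [x0 Ix0].
pose a := grad f x0; pose b := valL_ 0 f x0 - dotv a x0.
have nD (x : X) : enorm (set_val x - x0) ^+ 2 <= D ^+ 2.
  rewrite ler_pXn2r ?nnegrE ?enorm_ge0 ?(ltW D0)//.
  by apply: enorm_le_diam => //; [exact: set_valX|exact: interior_subset].
have fx0 (x : X) : `|f x - affine_fun a b x| <= kappa * D ^+ 2.
  apply: le_trans (ler_wpM2l kappa0 (nD x)).
  have := taylor_klip_grad domX kappa0 fk cf Ix0 (set_valX x).
  rewrite valL_val; congr (`|_ - _| <= _).
  by rewrite /affine_fun -/(dotv _ _) dotvBr -/a /b; ring.
(* The gradient of [h] is [2 * kappa]-Lipschitz, so the interpolation error is [delta ^+ 2 * kappa],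
   and [t * eps ^+ 2] is twice that. *)
pose t := 2 * w * kappa.
have t0 : 0 <= t by rewrite mulr_ge0// mulr_ge0// ltW.
have [t1|t1] := leP t 1; last first.
  exists (affine_fun a b); first by split; [exact: (interp_affine opI)|exact:
      affine_Hcons].
  move=> x; apply: (le_trans (fx0 x)).
  have : kappa * D ^+ 2 <= t * (kappa * D ^+ 2) by exact: (ler_peMl (mulr_ge0
      kappa0 (sqr_ge0 D)) (ltW t1)).
  by rewrite /t; lra.
have t01 : 0 <= t <= 1 by rewrite t0.
set h := (1 - t) *: f + t *: quad_fun a b x0.
(* Split into an affine function, which lies in [E], and a Lipschitz quadratic centred in [X]. *)
have Cq : Cb X (quad_fun a b x0).
  have [x0' x0E] := setX_val (interior_subset Ix0).
  have -> : quad_fun a b x0 =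
      1 *: affine_fun a b + 1 *: quad_fun 0 0 (set_val x0') :> (X -> R).
    apply/funext => x; rewrite !scale1r x0E.
    rewrite (_ : (_ + _) x = affine_fun a b x + quad_fun 0 0 x0 x)//.
    by rewrite /quad_fun /quadratic dotv0l !add0r.
  apply: Cb_comb; first exact/(interp_sub opI)/(interp_affine opI).
  exact: klip_Cb (klip_quad_fun _ _).
have Ch : Cb X h by apply: Cb_comb => //; case: Hf.
(* Since [kappa >= 1], the constant [(1 - t) * kappa + 2 * t] is at most [(1 + t) * kappa]. *)
have hk : klip_grad (2 * kappa) h.
  have [hd hL] := klip_grad_comb a b x0 t01 fk; split=> // x y Ix Iy.
  rewrite (le_trans (hL _ _ Ix Iy))// ler_wpM2r ?enorm_ge0//.
  by have := ler_wpM2l t0 kappa1; have := ler_wpM2l t0 kappa0; have :=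
      ler_wpM2r kappa0 t1; lra.
have kappa20 : 0 <= 2 * kappa by lra.
have he := interp_L3_le kappa20 Ch hk.
exists (I h).
  split; first exact: (interp_range opI).
  apply: (interp_Hcons Hf t01 _ Ch he).
    by have := mulr_ge0 (sqr_ge0 delta) kappa0; lra.
  by rewrite deltaE /t; lra.
move=> x; apply: (le_trans (interp_dist t0 (he x) (lerD (fx0 x) (nD x)))).
(* The constant 5 is 4 + 1: mixing costs at most [4 * w * kappa ^+ 2 * D ^+ 2], and interpolation at
   most [w * kappa ^+ 2 * D ^+ 2]. *)
have e1 : t * (kappa * D ^+ 2 + D ^+ 2) <= t * (kappa * D ^+ 2 + kappa * D ^+ 2).
  by rewrite ler_wpM2l// lerD2l ler_peMl ?sqr_ge0.
have e2 : delta ^+ 2 * kappa <= w * D ^+ 2 * kappa by rewrite ler_wpM2r.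
by move: e1; rewrite /t; lra.
Qed.

End Interpolation.

Theorem theorem2p12 (R : realType) :
  exists (C : R) (Cd : nat -> R),
  forall (d : nat) (X : set 'rV[R]_d)
    (E : set (X -> R)) (I : (X -> R) -> X -> R) (CI delta : R)
    (eps : R) (U : set 'rV[R]_d),
  bounded_convex_domain X ->
  1 <= CI -> 0 < delta -> interpolation_operator E I CI delta ->
  0 < eps -> boundary_net X eps U ->
  [/\ forall gamma : R, 2 * CI * diam X <= gamma ->
        (dH (BLip X gamma `&` E `&` Hcons (Mconstr X eps U))
            (BLip X gamma `&` Hconv X)
         <= (Cd d * gamma * eps)%:E)%E,
      forall gamma : R, 2 * CI * diam X <= gamma -> eps <= diam X ->
        (dH (BLip X (gamma / CI) `&` Hconv X)
            (BLip X gamma `&` E `&` Hcons (Mconstr X eps U))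
         <= (C * (gamma ^+ 2 * delta / eps ^+ 2) * diam X)%:E)%E
    & forall kappa : R, 1 <= kappa -> eps <= diam X ->
        (dH (BC11 X kappa `&` Hconv X)
            (E `&` Hcons (Mconstr X eps U))
         <= (C * kappa ^+ 2 * diam X ^+ 2 * (delta ^+ 2 / eps ^+ 2))%:E)%E].

Proof.
exists 5, (fun d => 8 * d%:R) => d X E I CI delta eps U domX CI1 delta0 opI eps0 netU.
split=> [gamma gammaD|gamma gammaD epsD|kappa kappa1 epsD].
- apply: dH_Lip_convex => //; rewrite (le_trans _ gammaD)// mulr_ge0 ?diam_ge0//.
  by rewrite mulr_ge0// (le_trans ler01).
- exact: (dH_convex_Lip domX eps0 opI).
- exact: (dH_convex_C11 domX eps0 opI).
Qed.
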